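(* The two-input system \[ \dot{x}_1=u_1,\qquad \dot{x}_2=u_2,\qquad \dot{x}_3=x_1+\frac{u_2^2}{2u_1} \] with state $x=(x_1,x_2,x_3)$ and input $u=(u_1,u_2)$ (on the domain $u_1\neq 0$) does not possess any $(x,u)$-flat output.
   Context: Conventions. All functions are smooth, all distributions are assumed to have locally constant dimension, all statements are local, and only generic points are considered. Time derivatives. For a system $\dot x=f(x,u)$ with $x=(x_1,\ldots,x_n)$ and $u=(u_1,u_2)$, the time derivative of a function $h(x,u,\dot u,\ldots,u^{(k)})$ along the system is the function $\dot h=\sum_{i=1}^n f_i(x,u)\,\frac{\partial h}{\partial x_i}+\sum_{l=0}^{k}\sum_{j=1}^{2}u_j^{(l+1)}\frac{\partial h}{\partial u_j^{(l)}}$, where $x,u,\dot u,\ddot u,\ldots$ are treated as independent coordinates; $h^{(\beta)}$ denotes the $\beta$-th iterated time derivative. Flatness. The system $\dot x=f(x,u)$ is called flat if there exist two functions $y_j=\varphi_j(x,u,\dot u,\ldots,u^{(q)})$, $j=1,2$, and smooth functions $F_{x_i}$, $F_{u_j}$ such that locally $x_i=F_{x_i}(\varphi,\dot\varphi,\ldots,\varphi^{(r-1)})$ for $i=1,\ldots,n$ and $u_j=F_{u_j}(\varphi,\dot\varphi,\ldots,\varphi^{(r)})$ for $j=1,2$. Then $y=\varphi=(\varphi_1,\varphi_2)$ is called an $(x,u,\dot u,\ldots,u^{(q)})$-flat output. An $(x,u)$-flat output is a flat output $\varphi(x,u)$ which may depend on the state $x$ and the input $u$, but not on time derivatives of $u$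 (in particular, it may depend on $x$ only). *)

(* Defs.v *)
From HB Require Import structures.
From mathcomp Require Import all_boot all_order all_algebra.
From mathcomp Require Import all_classical all_reals all_analysis.

Set Implicit Arguments.
Unset Strict Implicit.
Unset Printing Implicit Defensive.

Import Order.TTheory GRing.Theory Num.Theory.
Import numFieldNormedType.Exports.

Local Open Scope classical_set_scope.
Local Open Scope ring_scope.

(* C^oo on a set [U] (meant to be open): the iterated directional derivatives
   along any list of directions are all differentiable on [U].  Values of [f]
   outside [U] play no role. *)
Definition smooth_on (R : realType) (V W : normedModType R)
    (U : set V) (f : V -> W) : Prop :=
  forall (s : seq V) (x : V), U x ->
    differentiable (foldr (fun v g => 'D_v g) f s) x.

(* The space with coordinates (x, u, u', ..., u^(k)): [p.1] is x, and row [l]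
   of the matrix [p.2] is u^(l). *)
Definition jet (R : realType) (n m k : nat) : normedModType R :=
  ('rV[R]_n * 'M[R]_(k.+1, m))%type.

(* Forgets u^(k+1), ..., u^(K); only used with k <= K, where [inord l] has
   value [l]. *)
Definition jet_trunc (R : realType) (n m k K : nat) (p : jet R n m K) :
    jet R n m k :=
  (p.1, \matrix_(l < k.+1, j < m) p.2 (inord l) j).

(* The time derivative along x' = f(x, u) of a function of
   (x, u, ..., u^(k)), as a function of (x, u, ..., u^(k+1)); the directional
   derivatives are those with respect to x_i and to u_j^(l). *)
Definition time_deriv (R : realType) (n m : nat)
    (f : 'rV[R]_n -> 'rV[R]_m -> 'rV[R]_n) (k : nat)
    (h : jet R n m k -> R) (p : jet R n m k.+1) : R :=
  \sum_(i < n) f p.1 (row ord0 p.2) 0 i *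
     'D_((delta_mx 0 i, 0) : jet R n m k) h (jet_trunc k p)
  + \sum_(l < k.+1) \sum_(j < m) p.2 (lift ord0 l) j *
     'D_((0, delta_mx l j) : jet R n m k) h (jet_trunc k p).

Fixpoint time_derivn (R : realType) (n m : nat)
    (f : 'rV[R]_n -> 'rV[R]_m -> 'rV[R]_n) (k : nat)
    (h : jet R n m k -> R) (b : nat) : jet R n m (b + k) -> R :=
  match b return jet R n m (b + k) -> R with
  | 0%N => h
  | b'.+1 => time_deriv f (@time_derivn R n m f k h b')
  end.
Arguments time_derivn {R n m} f {k} h b p.

(* The matrix with rows phi, phi', ..., phi^(s-1) at a point of a jet space
   of sufficiently high order K (s - 1 + q <= K). *)
Definition output_jet (R : realType) (n m : nat)
    (f : 'rV[R]_n -> 'rV[R]_m -> 'rV[R]_n) (q : nat)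
    (phi : 'I_m -> jet R n m q -> R) (s K : nat) (p : jet R n m K) :
    'M[R]_(s, m) :=
  \matrix_(b < s, j < m) time_derivn f (phi j) b (jet_trunc (b + q) p).

(* [phi] is an (x, u, ..., u^(q))-flat output of x' = f(x, u), where (x, u) is
   restricted to [D].  Flatness is local and generic, so the identities are
   only required on some nonempty open set [W] of the space of
   (x, u, ..., u^(r+q)); [phi], [Fx] and [Fu] are smooth on open sets [U],
   [Vx] and [Vu] containing all the points at which [W] evaluates them. *)
Definition flat_output (R : realType) (n m : nat)
    (f : 'rV[R]_n -> 'rV[R]_m -> 'rV[R]_n)
    (D : set ('rV[R]_n * 'rV[R]_m)) (q : nat)
    (phi : 'I_m -> jet R n m q -> R) : Prop :=
  exists (r : nat) (W : set (jet R n m (r + q))) (U : set (jet R n m q))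
         (Vx : set 'M[R]_(r, m)) (Vu : set 'M[R]_(r.+1, m))
         (Fx : 'I_n -> 'M[R]_(r, m) -> R) (Fu : 'I_m -> 'M[R]_(r.+1, m) -> R),
    [/\ [/\ open W, W !=set0, open U, open Vx & open Vu],
        forall j, smooth_on U (phi j),
        forall i, smooth_on Vx (Fx i),
        forall j, smooth_on Vu (Fu j) &
        forall p, W p ->
          [/\ D (p.1, row ord0 p.2),
              U (jet_trunc q p),
              Vx (output_jet f phi r p) /\ Vu (output_jet f phi r.+1 p),
              forall i, p.1 0 i = Fx i (output_jet f phi r p) &
              forall j, p.2 ord0 j = Fu j (output_jet f phi r.+1 p)]].

(* Flat outputs depending on (x, u) only are those of order q = 0. *)
Definition xu_flat_output (R : realType) (n m : nat)
    (f : 'rV[R]_n -> 'rV[R]_m -> 'rV[R]_n)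
    (D : set ('rV[R]_n * 'rV[R]_m)) (phi : 'I_m -> jet R n m 0 -> R) : Prop :=
  flat_output f D phi.

Definition sys (R : realType) (x : 'rV[R]_3) (u : 'rV[R]_2) : 'rV[R]_3 :=
  \row_(i < 3)
    [:: u 0 0; u 0 1; x 0 0 + u 0 1 ^+ 2 / (2 * u 0 0)]`_i.

Definition sys_dom (R : realType) : set ('rV[R]_3 * 'rV[R]_2) :=
  [set xu : 'rV[R]_3 * 'rV[R]_2 | xu.2 0 0 != 0].

(* Main.v *)
Require Import Defs.
From mathcomp Require Import all_boot all_order all_algebra.
From mathcomp Require Import all_classical all_reals all_analysis.
From mathcomp Require Import ring lra.

Set Implicit Arguments.
Unset Strict Implicit.
Unset Printing Implicit Defensive.

Import Order.TTheory GRing.Theory Num.Theory.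
Import numFieldNormedType.Exports.

Local Open Scope classical_set_scope.
Local Open Scope ring_scope.

(** Write f(x,u) for the right-hand side and s for the slope u_2/u_1.  For
    fixed x the velocities f(x,u) fill a cone with apex (0, 0, x_1); its rulings
    are the lines s = const, and its conormal along a ruling is
    (s^2/2, -s, 1).

    Let T be the total derivative on a jet space and L its Lie derivative on
    one-forms, so that d(T^b phi) = L^b (d phi) ([lie_grad]).  If phi is a flat
    output, a tangent vector annihilated by all L^b (d phi_j) has zero
    components along x and u ([flat_output_kernel]).  On the other hand, if the
    du-parts of two forms in dx and du are independent, L^b of these forms has
    independent components along du^(b), so every common zero of the two forms
    in the (x,u)-directions extends to a zero of all their Lie derivatives
    ([annul_extend]).  Since dx and du are five differentials, two such forms
    together with two further forms in dx and du always leave a nonzero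
    (x,u)-direction.  Hence d phi_1, d phi_2 and their Lie derivatives cannot be
    generated, over functions, by so few forms ([too_few_forms]).  All is
    local, and open sets are shrunk to make nonzero functions invertible.

    This excludes the possible ranks of the Jacobian of phi with respect to u.

    Rank two: d phi_1 and d phi_2 themselves are the two forms
    ([input_jacobian_det]).

    Rank zero ([input_free_absurd]): L (d phi_1) and L (d phi_2) are the two
    forms, unless the cross product of the gradients of phi_1 and phi_2, which
    does not depend on u, is orthogonal to all the conormals of the cone.  As
    these span the space, the gradients are then proportional, which leaves too
    few forms again.

    Rank one ([input_dependent_absurd]): say phi_1 depends on u.  Let E be the
    vector field in the u-directions that annihilates phi_1 and phi_2.  Then
    d phi_2 = c d phi_1 + omega with omega a form in dx, and the counting
    argument gives omega(Ef) = 0.  So L omega = c_1 d phi_1 + zeta with zeta a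
    form in dx, and counting gives zeta(Ef) = 0 and the independence of omega
    and zeta.  Differentiation of the two orthogonality relations yields
    omega(EEf) = zeta(EEf) = 0, so EEf is parallel to Ef: E moves the velocity
    along a straight line.  The straight lines on the cone are its rulings, so E
    is proportional to u_1 d/du_1 + u_2 d/du_2 ([straight_line_is_ruling]).
    Then omega is a multiple of the conormal of the cone, c_1 = 0, and the
    relation zeta(Ef) = 0 reads omega_3 = 0, because of the drift x_1 in the
    third equation.  Hence omega = 0, a contradiction
    ([straight_lines_absurd]). *)

(** * Symmetry of second derivatives *)

Section Young.
Variables (R : realType) (V : normedModType R).
Implicit Types (f g : V -> R) (U : set V).

Definition mixed_diff f p v w (h : R) :=
  f (p + h *: v + h *: w) - f (p + h *: v) - f (p + h *: w) + f p.

Lemma differentiable_bound g p (e : R) : differentiable g p -> 0 < e ->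
  exists2 d, 0 < d & forall z, `|z| < d ->
    `|g (p + z) - g p - 'd g p z| <= e * `|z|.
Proof.
move=> dg e0; have /diff_locallyx/= H := dg.
have /eqaddoP/(_ e e0) : (fun h => g (h + p)) = (fun h => g p + 'd g p h) +o_ (nbhs (0:V)) id.
  apply/eqaddoE; rewrite funeqE => h; rewrite H //.
move=> /nbhs_normP[d d0 Hd]; exists d => // z zd.
have := Hd z; rewrite /= sub0r normrN => /(_ zd).
by rewrite !fctE opprD addrA (addrC z).
Qed.

Lemma is_derive_line f p v (s : R) : differentiable f (p + s *: v) ->
  is_derive s 1 (fun t : R => f (p + t *: v)) ('D_v f (p + s *: v)).
Proof.
move=> df; have dl : is_diff s (fun t : R => p + t *: v) (fun t => t *: v).
  have -> : (fun t : R => t *: v) = 0 + (fun t : R => t *: v) by rewrite add0r.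
  apply: is_diffD.
have [dl1 dl2] := dl.
have dd : differentiable (f \o (fun t : R => p + t *: v)) s.
  exact: differentiable_comp.
apply: DeriveDef; first exact: diff_derivable.
by rewrite deriveE // (diff_comp dl1 df) /= dl2 scale1r deriveE.
Qed.

(** The mean value theorem in the direction [v] turns the mixed difference into
    [h] times an increment of [ 'D_v f ] along [w]; differentiability of
    [ 'D_v f ] at the single point [p] then suffices. *)
Lemma mixed_diff_approx f U p v w (e : R) : open U -> U p ->
  (forall x, U x -> differentiable f x) -> differentiable ('D_v f) p ->
  0 < e -> exists2 d, 0 < d & forall h, 0 < h -> h < d ->
  `|mixed_diff f p v w h - h ^+ 2 * 'D_w ('D_v f) p| <= e * h ^+ 2.
Proof.
move=> oU Up df dg e0.
have /nbhs_normP[dU dU0 HU] : nbhs p U by exact: open_nbhs_nbhs.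
set M := 1 + `|v| + `|w|.
have M0 : 0 < M by rewrite /M -addrA ltr_wpDr // addr_ge0.
have e'0 : 0 < e / (2 * M) by rewrite divr_gt0 // mulr_gt0.
have [dg' dg0 Hg] := differentiable_bound dg e'0.
exists (Num.min dU dg' / M); first by rewrite divr_gt0 // lt_min dU0 dg0.
move=> h h0; rewrite ltr_pdivlMr // lt_min => /andP[hU hg].
have small c : 0 <= c -> c <= h -> `|c *: v| + `|h *: w| <= h * M.
  move=> c0 ch; rewrite !normrZ (gtr0_norm h0) (ger0_norm c0).
  by have := normr_ge0 v; have := normr_ge0 w; rewrite /M; nra.
have inU c z : 0 <= c -> c <= h -> (z = 0) \/ (z = h *: w) -> U (p + c *: v + z).
  move=> c0 ch zz; apply: HU => /=; rewrite -addrA opprD addrA subrr sub0r normrN.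
  apply: le_lt_trans hU; apply: le_trans (small _ c0 ch).
  apply: le_trans (ler_normD _ _) _; rewrite lerD2l.
  by case: zz => -> //; rewrite normr0.
(* The mixed difference is the increment of [G] over [0, h]. *)
pose G s := f ((p + h *: w) + s *: v) - f (p + s *: v).
pose G' s := 'D_v f ((p + h *: w) + s *: v) - 'D_v f (p + s *: v).
have dG s : 0 <= s -> s <= h -> is_derive s 1 G (G' s).
  move=> s0 sh; apply: is_deriveB; apply: is_derive_line; apply: df.
  - by rewrite addrAC; apply: inU => //; right.
  - by rewrite -[_ + _]addr0; apply: inU => //; left.
have [||c] := @MVT R G G' 0 h h0.
- by move=> x; rewrite in_itv /= => /andP[/ltW ? /ltW ?]; exact: dG.
- apply: derivable_within_continuous => x.
  by rewrite in_itv /= => /andP[? ?]; apply: ex_derive; exact: dG.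
rewrite in_itv /= subr0 => /andP[c0 ch] GG.
have -> : mixed_diff f p v w h = G' c * h.
  rewrite -GG /mixed_diff /G scale0r !addr0 (addrAC p); ring.
have ndc : `|c *: v + h *: w| < dg'.
  apply: le_lt_trans hg; apply: le_trans (small _ (ltW c0) (ltW ch)).
  exact: ler_normD.
have nd0 : `|c *: v| < dg'.
  apply: le_lt_trans hg; apply: le_trans (small _ (ltW c0) (ltW ch)).
  by rewrite lerDl.
have := Hg _ ndc; have := Hg _ nd0.
have -> : 'd ('D_v f) p (c *: v + h *: w) =
    'd ('D_v f) p (c *: v) + h * 'd ('D_v f) p w.
  by rewrite linearD [X in _ + X]linearZ.
rewrite (deriveE _ dg) /G' -(addrA p (h *: w)) (addrC (h *: w)).
set A := 'D_v f _; set B := 'D_v f (p + (_ + _)); set C := 'D_v f p.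
set L := 'd _ _ _; set Lw := 'd _ _ _ => H1 H2.
have N1 : e / (2 * M) * `|c *: v| <= e / 2 * h.
  rewrite invfM mulrA -mulrA ler_pM2l ?divr_gt0 // ler_pdivrMl //.
  by rewrite mulrC (le_trans _ (small _ (ltW c0) (ltW ch))) // lerDl.
have N2 : e / (2 * M) * `|c *: v + h *: w| <= e / 2 * h.
  rewrite invfM mulrA -mulrA ler_pM2l ?divr_gt0 // ler_pdivrMl //.
  by rewrite mulrC (le_trans _ (small _ (ltW c0) (ltW ch))) // ler_normD.
have : `|B - A - h * Lw| <= e * h.
  have -> : B - A - h * Lw = (B - C - (L + h * Lw)) - (A - C - L) by ring.
  apply: le_trans (ler_normB _ _) _.
  apply: le_trans (lerD (le_trans H2 N2) (le_trans H1 N1)) _.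
  by rewrite le_eqVlt; apply/orP; left; apply/eqP; field.
move=> H3.
have -> : (B - A) * h - h ^+ 2 * Lw = h * (B - A - h * Lw) by ring.
have -> : e * h ^+ 2 = h * (e * h) by ring.
by rewrite normrM (gtr0_norm h0) ler_pM2l.
Qed.

(** Young's form of the symmetry of second derivatives: [mixed_diff] is
    symmetric in [v] and [w], and both second derivatives are its limit. *)
Lemma derive_swap f U p v w : open U -> U p ->
  (forall x, U x -> differentiable f x) ->
  differentiable ('D_v f) p -> differentiable ('D_w f) p ->
  'D_v ('D_w f) p = 'D_w ('D_v f) p.
Proof.
move=> oU Up df dv dw; apply/eqP; rewrite -subr_eq0 -normr_le0.
apply/ler_addgt0Pr => e e0; rewrite add0r.
have e20 : 0 < e / 2 by rewrite divr_gt0.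
have [d1 d10 H1] := mixed_diff_approx w oU Up df dv e20.
have [d2 d20 H2] := mixed_diff_approx v oU Up df dw e20.
pose h := Num.min d1 d2 / 2.
have m0 : 0 < Num.min d1 d2 by rewrite lt_min d10 d20.
have h0 : 0 < h by rewrite divr_gt0.
have : h < Num.min d1 d2 by rewrite /h; lra.
rewrite lt_min => /andP[hd1 hd2].
have := H1 _ h0 hd1; have := H2 _ h0 hd2.
have -> : mixed_diff f p w v h = mixed_diff f p v w h.
  rewrite /mixed_diff (addrAC p); ring.
set D := mixed_diff _ _ _ _ _; set a := 'D_v _ _; set b := 'D_w _ _ => K1 K2.
have h20 : 0 < h ^+ 2 by rewrite exprn_gt0.
rewrite -(ler_pM2l h20) -[X in X * `|_|](gtr0_norm h20) -normrM.
have -> : h ^+ 2 * (a - b) = (D - h ^+ 2 * b) - (D - h ^+ 2 * a) by ring.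
apply: le_trans (ler_normB _ _) _; apply: le_trans (lerD K2 K1) _.
by rewrite le_eqVlt; apply/orP; left; apply/eqP; field.
Qed.

End Young.

(** * Smooth functions on an open set *)

Section SmoothFunctions.
Variables (R : realType) (V : normedModType R) (W : set V).
Hypothesis oW : open W.
Implicit Types (f g : V -> R) (v w : V).

(** Stratifying smoothness by the order of differentiation gives an induction
    for products and inverses, whose derivatives are sums of products. *)
Fixpoint smooth_upto (n : nat) f : Prop :=
  (forall x, W x -> differentiable f x) /\
  (if n is n'.+1 then forall v, smooth_upto n' ('D_v f) else True).

Definition smooth f := forall n, smooth_upto n f.

Lemma near_open (P : V -> Prop) x : W x -> (forall y, W y -> P y) ->
  \forall y \near x, P y.
Proof. by move=> Wx H; apply: filterS (open_nbhs_nbhs (conj oW Wx)). Qed.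

Lemma derive_ext f g v : (forall x, W x -> f x = g x) ->
  forall x, W x -> 'D_v f x = 'D_v g x.
Proof. by move=> fg x Wx; apply: near_eq_derive; exact: near_open. Qed.

Lemma derive_cst_on f c v : (forall x, W x -> f x = c) ->
  forall x, W x -> 'D_v f x = 0.
Proof.
move=> fc x Wx; rewrite (derive_ext (g := cst c)) //; exact: derive_cst.
Qed.

Lemma differentiable_ext f g : (forall x, W x -> f x = g x) ->
  forall x, W x -> differentiable f x -> differentiable g x.
Proof.
move=> fg x Wx df.
have [dc H] : continuous 'd f x /\ g \o shift x = cst (g x) + 'd f x +o_ (0 : V) id.
  split; first exact: diff_continuous.
  have E := diff_locally df.
  have /eqaddoP Ho : f \o shift x = cst (f x) + 'd f x +o_ (0 : V) id by rewrite E.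
  have WN : \forall h \near (0 : V), W (h + x).
    have /nbhs_normP[d d0 Hd] : nbhs x W by exact: open_nbhs_nbhs.
    apply/nbhs_normP; exists d => // h /=; rewrite sub0r normrN => hd.
    by apply: Hd => /=; rewrite opprD addrCA subrr addr0 normrN.
  apply/eqaddoP => e e0; near=> h.
  have -> : (g \o shift x - (cst (g x) + 'd f x)) h =
            (f \o shift x - (cst (f x) + 'd f x)) h.
    rewrite !fctE /= -!fg //.
    by near: h.
  by near: h; exact: Ho.
apply/diff_locallyP; rewrite (_ : 'd g x = 'd f x :> (V -> R)) //.
exact: diff_unique.
Unshelve. all: by end_near. Qed.

Lemma smooth_upto_ext n f g : (forall x, W x -> f x = g x) ->
  smooth_upto n f -> smooth_upto n g.
Proof.
elim: n f g => [|n IH] f g fg /= [df D].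
  by split=> // x Wx; apply: differentiable_ext (df x Wx).
split=> [x Wx|v]; first by apply: differentiable_ext (df x Wx).
by apply: IH (D v); exact: derive_ext.
Qed.

Lemma smooth_uptoW n f : smooth_upto n.+1 f -> smooth_upto n f.
Proof.
elim: n f => [|n IH] f /= [df D]; first by split.
by split=> // v; apply: IH; exact: D.
Qed.

Lemma smooth_upto_diff n f x : smooth_upto n f -> W x -> differentiable f x.
Proof. by case: n => [|n] /= [df _]; exact: df. Qed.

Lemma smooth_upto_cst n c : smooth_upto n (fun=> c).
Proof.
elim: n c => [|n IH] c /=; first by split=> // x _; exact: differentiable_cst.
split=> [x _|v]; first exact: differentiable_cst.
by apply: smooth_upto_ext (IH 0) => x Wx; rewrite derive_cst.
Qed.

Lemma smooth_uptoD n f g : smooth_upto n f -> smooth_upto n g ->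
  smooth_upto n (fun x => f x + g x).
Proof.
elim: n f g => [|n IH] f g /= [df Df] [dg Dg].
  by split=> // x Wx; apply: differentiableD; [exact: df|exact: dg].
split=> [x Wx|v]; first by apply: differentiableD; [exact: df|exact: dg].
apply: smooth_upto_ext (IH _ _ (Df v) (Dg v)) => x Wx.
by rewrite deriveD //; apply: diff_derivable; [exact: df|exact: dg].
Qed.

Lemma smooth_uptoM n f g : smooth_upto n f -> smooth_upto n g ->
  smooth_upto n (fun x => f x * g x).
Proof.
elim: n f g => [|n IH] f g.
  move=> [df _] [dg _]; split=> // x Wx.
  by apply: differentiableM; [exact: df|exact: dg].
move=> Sf Sg; have [df Df] := Sf; have [dg Dg] := Sg.
split=> [x Wx|v]; first by apply: differentiableM; [exact: df|exact: dg].
have SD := smooth_uptoD (IH _ _ (smooth_uptoW Sf) (Dg v))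
                        (IH _ _ (smooth_uptoW Sg) (Df v)).
apply: smooth_upto_ext SD => x Wx.
by rewrite deriveM //; apply: diff_derivable; [exact: df|exact: dg].
Qed.

Lemma smooth_uptoV n f : (forall x, W x -> f x != 0) -> smooth_upto n f ->
  smooth_upto n (fun x => (f x)^-1).
Proof.
move=> f0; elim: n => [|n IH].
  move=> [df _]; split=> // x Wx; apply: differentiableV; [exact: df|exact: f0].
move=> Sf; have [df Df] := Sf.
split=> [x Wx|v]; first by apply: differentiableV; [exact: df|exact: f0].
have SV := IH (smooth_uptoW Sf).
have SD := smooth_uptoM (smooth_upto_cst n (-1))
             (smooth_uptoM (Df v) (smooth_uptoM SV SV)).
apply: smooth_upto_ext SD => x Wx.
rewrite deriveV; [|exact: f0|by apply: diff_derivable; exact: df].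
by rewrite /GRing.scale /= -exprVn expr2; ring.
Qed.

Lemma smooth_diff f x : smooth f -> W x -> differentiable f x.
Proof. by move=> /(_ 0%N)/smooth_upto_diff; exact. Qed.

Lemma smooth_ext f g : (forall x, W x -> f x = g x) -> smooth f -> smooth g.
Proof. by move=> fg sf n; exact: smooth_upto_ext (sf n). Qed.

Lemma smooth_cst c : smooth (fun=> c).
Proof. by move=> n; exact: smooth_upto_cst. Qed.

Lemma smoothD f g : smooth f -> smooth g -> smooth (fun x => f x + g x).
Proof. by move=> sf sg n; exact: smooth_uptoD. Qed.

Lemma smoothM f g : smooth f -> smooth g -> smooth (fun x => f x * g x).
Proof. by move=> sf sg n; exact: smooth_uptoM. Qed.

Lemma smoothN f : smooth f -> smooth (fun x => - f x).
Proof.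
move=> sf; apply: smooth_ext (smoothM (smooth_cst (-1)) sf) => x _.
by rewrite mulN1r.
Qed.

Lemma smoothB f g : smooth f -> smooth g -> smooth (fun x => f x - g x).
Proof. by move=> sf sg; apply: smoothD sf (smoothN sg). Qed.

Lemma smooth_dot3 a0 a1 a2 b0 b1 b2 : smooth a0 -> smooth a1 -> smooth a2 ->
  smooth b0 -> smooth b1 -> smooth b2 ->
  smooth (fun x => a0 x * b0 x + a1 x * b1 x + a2 x * b2 x).
Proof.
by move=> sa0 sa1 sa2 sb0 sb1 sb2; do 2?apply: smoothD; exact: smoothM.
Qed.

Lemma smooth_minor a0 a1 b0 b1 : smooth a0 -> smooth a1 -> smooth b0 ->
  smooth b1 -> smooth (fun x => a0 x * b1 x - a1 x * b0 x).
Proof. by move=> sa0 sa1 sb0 sb1; apply: smoothB; exact: smoothM. Qed.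

Lemma smoothV f : (forall x, W x -> f x != 0) -> smooth f ->
  smooth (fun x => (f x)^-1).
Proof. by move=> f0 sf n; exact: smooth_uptoV. Qed.

Lemma smooth_sum (I : finType) (F : I -> V -> R) : (forall i, smooth (F i)) ->
  smooth (fun x => \sum_i F i x).
Proof.
move=> sF; suff H (s : seq I) : smooth (fun x => \sum_(i <- s) F i x) by exact: H.
elim: s => [|i s IH].
  by apply: smooth_ext (smooth_cst 0) => x _; rewrite big_nil.
by apply: smooth_ext (smoothD (sF i) IH) => x _; rewrite big_cons.
Qed.

Lemma smooth_derive f v : smooth f -> smooth ('D_v f).
Proof. by move=> sf n; have [_] := sf n.+1; exact. Qed.

Lemma smooth_onW U f : W `<=` U -> smooth_on U f -> smooth f.
Proof.
move=> WU sf n; elim: n f sf => [|n IH] f sf.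
  by split=> // x /WU Ux; exact: (sf [::]).
split=> [x /WU Ux|v]; first exact: (sf [::]).
apply: IH => s x Ux; have := sf (rcons s v) x Ux.
by rewrite foldr_rcons.
Qed.

(** The rules of differentiation for functions given by their values, as they
    occur in explicit formulas. *)
Section Rules.
Variables (f g : V -> R) (v x : V).
Hypotheses (sf : smooth f) (sg : smooth g) (Wx : W x).

Let df : derivable f x v. Proof. exact: diff_derivable (smooth_diff sf Wx). Qed.
Let dg : derivable g x v. Proof. exact: diff_derivable (smooth_diff sg Wx). Qed.

Lemma deriveD_on : 'D_v (fun y => f y + g y) x = 'D_v f x + 'D_v g x.
Proof. exact: deriveD. Qed.

Lemma deriveM_on : 'D_v (fun y => f y * g y) x = 'D_v f x * g x + f x * 'D_v g x.
Proof. by rewrite [LHS](deriveM df dg) /GRing.scale /= addrC mulrC. Qed.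

End Rules.

Lemma deriveV_on f v x : smooth f -> W x -> f x != 0 ->
  'D_v (fun y => (f y)^-1) x = - ('D_v f x / f x ^+ 2).
Proof.
move=> sf Wx f0; rewrite deriveV //; last exact: diff_derivable (smooth_diff sf Wx).
by rewrite /GRing.scale /= mulNr mulrC.
Qed.

Lemma derive_sum_on (I : finType) (F : I -> V -> R) v x : (forall i, smooth (F i)) ->
  W x -> 'D_v (fun y => \sum_i F i y) x = \sum_i 'D_v (F i) x.
Proof.
move=> sF Wx.
have sFs (s : seq I) : smooth (fun x => \sum_(i <- s) F i x).
  elim: s => [|i s IH].
    by apply: smooth_ext (smooth_cst 0) => y _; rewrite big_nil.
  by apply: smooth_ext (smoothD (sF i) IH) => y _; rewrite big_cons.
suff H (s : seq I) :
  'D_v (fun y => \sum_(i <- s) F i y) x = \sum_(i <- s) 'D_v (F i) x by exact: H.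
elim: s => [|i s IH].
  by rewrite big_nil; apply: (derive_cst_on (c := 0)) => // y _; rewrite big_nil.
rewrite big_cons -IH -(deriveD_on _ (sF i) (sFs s) Wx).
by apply: derive_ext => // y _; rewrite big_cons.
Qed.

Lemma derive_swap_on f v w x : smooth f -> W x -> 'D_v ('D_w f) x = 'D_w ('D_v f) x.
Proof.
move=> sf Wx; apply: (derive_swap oW Wx).
- by move=> y; exact: smooth_diff.
- exact: smooth_diff (smooth_derive v sf) Wx.
- exact: smooth_diff (smooth_derive w sf) Wx.
Qed.

Lemma open_neq0 f : smooth f -> open (W `&` [set y | f y != 0]).
Proof.
move=> sf; rewrite openE => x [Wx fx]; apply: filterI.
  exact: open_nbhs_nbhs.
apply: cvgr_neq0 fx.
exact: differentiable_continuous (smooth_diff sf Wx).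
Qed.

End SmoothFunctions.

Lemma smooth_sub (R : realType) (V : normedModType R) (W W' : set V) h :
  W' `<=` W -> smooth W h -> smooth W' h.
Proof.
move=> WW sh N; elim: N h {sh}(sh N) => [|N IH] h /= [dh Dh].
  by split=> // x /WW; exact: dh.
by split=> [x /WW|v]; [exact: dh|exact: IH].
Qed.

(** * One-forms and the Lie derivative along a vector field *)

Section Forms.
Variables (R : realType) (V : normedModType R) (W : set V).
Hypothesis oW : open W.
Variables (I : finType) (e : I -> V) (tau : I -> V -> R).
Hypothesis stau : forall k, smooth W (tau k).
Implicit Types (f g h : V -> R) (eta theta : I -> V -> R) (v : I -> R).

(** The vector field [\sum_k tau k *: e k], acting on functions. *)
Definition vfield f x := \sum_k tau k x * 'D_(e k) f x.

Definition grad f k x := 'D_(e k) f x.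

(** A one-form is given by its components along the constant fields [e k].
    Since the bracket of the vector field with [e k] is
    [- \sum_j 'D_(e k) (tau j) *: e j], this is the Lie derivative. *)
Definition lie eta k x :=
  vfield (eta k) x + \sum_j 'D_(e k) (tau j) x * eta j x.

Definition pairing eta v x := \sum_k v k * eta k x.

(** [v] is a tangent vector at [x] on which [eta] and its first [b] Lie
    derivatives vanish. *)
Definition annul b eta v x :=
  forall i, (i <= b)%N -> pairing (iter i lie eta) v x = 0.

Lemma vfield_ext f g : (forall x, W x -> f x = g x) ->
  forall x, W x -> vfield f x = vfield g x.
Proof.
by move=> fg x Wx; apply: eq_bigr => k _; rewrite (derive_ext oW _ fg).
Qed.

Lemma vfield_cst f c : (forall x, W x -> f x = c) ->
  forall x, W x -> vfield f x = 0.
Proof.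
move=> fc x Wx; rewrite /vfield big1 // => k _.
by rewrite (derive_cst_on oW _ fc) ?mulr0.
Qed.

Lemma smooth_vfield f : smooth W f -> smooth W (vfield f).
Proof.
by move=> sf; apply: smooth_sum => // k; apply: smoothM => //; exact: smooth_derive.
Qed.

Lemma vfieldD f g x : smooth W f -> smooth W g -> W x ->
  vfield (fun y => f y + g y) x = vfield f x + vfield g x.
Proof.
move=> sf sg Wx; rewrite /vfield -big_split /=; apply: eq_bigr => k _.
by rewrite (deriveD_on _ sf sg) // mulrDr.
Qed.

Lemma vfieldM f g x : smooth W f -> smooth W g -> W x ->
  vfield (fun y => f y * g y) x = vfield f x * g x + f x * vfield g x.
Proof.
move=> sf sg Wx; rewrite /vfield mulr_suml mulr_sumr -big_split /=.
by apply: eq_bigr => k _; rewrite (deriveM_on _ sf sg) //; ring.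
Qed.

Lemma smooth_grad f : smooth W f -> forall k, smooth W (grad f k).
Proof. by move=> sf k; exact: smooth_derive. Qed.

Lemma smooth_lie eta : (forall k, smooth W (eta k)) ->
  forall k, smooth W (lie eta k).
Proof.
move=> se k; apply: smoothD => //; first exact: smooth_vfield.
by apply: smooth_sum => // j; apply: smoothM => //; exact: smooth_derive.
Qed.

Lemma lie_ext eta theta : (forall k x, W x -> eta k x = theta k x) ->
  forall k x, W x -> lie eta k x = lie theta k x.
Proof.
move=> et k x Wx; rewrite /lie; congr (_ + _); first exact: vfield_ext (et k) x Wx.
by apply: eq_bigr => j _; rewrite et.
Qed.

Lemma lieD eta theta k x :
  (forall k, smooth W (eta k)) -> (forall k, smooth W (theta k)) -> W x ->
  lie (fun k y => eta k y + theta k y) k x = lie eta k x + lie theta k x.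
Proof.
move=> se st Wx; rewrite /lie vfieldD // addrACA; congr (_ + _).
by rewrite -big_split /=; apply: eq_bigr => j _; rewrite mulrDr.
Qed.

Lemma lieZ c eta k x : smooth W c -> (forall k, smooth W (eta k)) -> W x ->
  lie (fun k y => c y * eta k y) k x =
  vfield c x * eta k x + c x * lie eta k x.
Proof.
move=> sc se Wx; rewrite /lie vfieldM // -addrA mulrDr; congr (_ + (_ + _)).
by rewrite mulr_sumr; apply: eq_bigr => j _; rewrite mulrCA.
Qed.

(** The Lie derivative commutes with the exterior derivative; this is where the
    symmetry of second derivatives enters. *)
Lemma lie_grad f k x : smooth W f -> W x ->
  lie (grad f) k x = grad (vfield f) k x.
Proof.
move=> sf Wx; rewrite /lie /grad /vfield (derive_sum_on oW) //; last first.
  by move=> j; apply: smoothM => //; exact: smooth_derive.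
rewrite -big_split /=; apply: eq_bigr => j _.
rewrite (deriveM_on _ (stau j) (smooth_derive (e j) sf)) // addrC.
by rewrite (derive_swap_on oW (e k) (e j) sf Wx).
Qed.

Lemma pairing_ext eta theta v x : (forall k, eta k x = theta k x) ->
  pairing eta v x = pairing theta v x.
Proof. by move=> et; apply: eq_bigr => k _; rewrite et. Qed.

Lemma iter_lie_ext i eta theta : (forall k x, W x -> eta k x = theta k x) ->
  forall k x, W x -> iter i lie eta k x = iter i lie theta k x.
Proof. by move=> et; elim: i => [|i IH] //=; exact: lie_ext. Qed.

Lemma annul_ext b eta theta v x : W x ->
  (forall k y, W y -> eta k y = theta k y) ->
  annul b eta v x -> annul b theta v x.
Proof.
move=> Wx et A i ib; rewrite -(A i ib); apply: pairing_ext => k.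
by rewrite (iter_lie_ext i et).
Qed.

Lemma annulS b eta v x :
  annul b.+1 eta v x <-> pairing eta v x = 0 /\ annul b (lie eta) v x.
Proof.
split=> [A|[A0 A] [|i] ib]; rewrite ?iterSr; [|exact: A0|exact: A].
by split=> [|i ib]; [exact: (A 0%N)|rewrite -iterSr; exact: A].
Qed.

Lemma annul_le b b' eta v x : (b <= b')%N -> annul b' eta v x -> annul b eta v x.
Proof. by move=> bb' A i ib; apply: A; exact: leq_trans ib bb'. Qed.

Lemma annulD b eta theta v x :
  (forall k, smooth W (eta k)) -> (forall k, smooth W (theta k)) -> W x ->
  annul b eta v x -> annul b theta v x ->
  annul b (fun k y => eta k y + theta k y) v x.
Proof.
move=> + + Wx; elim: b eta theta => [|b IH] eta theta se st A B.
  move=> i; rewrite leqn0 => /eqP ->; have := A 0%N isT; have := B 0%N isT.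
  rewrite /= /pairing => B0 A0; under eq_bigr do rewrite mulrDr.
  by rewrite big_split /= A0 B0 addr0.
have [A0 A'] := (annulS _ _ _ _).1 A; have [B0 B'] := (annulS _ _ _ _).1 B.
apply/annulS; split.
  rewrite /pairing; under eq_bigr do rewrite mulrDr.
  by rewrite big_split /=; rewrite /pairing in A0 B0; rewrite A0 B0 addr0.
apply: (annul_ext Wx (fun k y Wy => esym (lieD k se st Wy))).
by apply: IH => //; exact: smooth_lie.
Qed.

(** The Leibniz rule keeps the annihilator of a form and of its Lie derivatives
    stable under multiplication by functions; so [annul] only depends on the
    module of forms generated over functions and Lie derivatives. *)
Lemma annulZ b c eta v x : smooth W c -> (forall k, smooth W (eta k)) -> W x ->
  annul b eta v x -> annul b (fun k y => c y * eta k y) v x.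
Proof.
move=> + + Wx; elim: b c eta => [|b IH] c eta sc se A.
  move=> i; rewrite leqn0 => /eqP ->; have := A 0%N isT; rewrite /= /pairing => A0.
  by under eq_bigr do rewrite mulrCA; rewrite -mulr_sumr A0 mulr0.
have [A0 A'] := (annulS _ _ _ _).1 A.
apply/annulS; split.
  rewrite /pairing in A0 *.
  by under eq_bigr do rewrite mulrCA; rewrite -mulr_sumr A0 mulr0.
apply: (annul_ext Wx (fun k y Wy => esym (lieZ k sc se Wy))).
have sl := smooth_lie se; have sT := smooth_vfield sc.
apply: annulD => //.
- by move=> k; exact: smoothM.
- by move=> k; exact: smoothM.
- by apply: IH => //; apply: annul_le A; exact: leqnSn.
- exact: IH.
Qed.

Lemma iter_lie_grad i f k x : smooth W f -> W x ->
  iter i lie (grad f) k x = grad (iter i vfield f) k x.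
Proof.
move=> sf; elim: i k x => [|i IH] k x Wx //=.
rewrite -lie_grad //; first exact: lie_ext IH k x Wx.
by elim: {IH} i => //= i IH; exact: smooth_vfield.
Qed.

Lemma annul_grad b f v x : smooth W f -> W x -> annul b (grad f) v x ->
  forall i, (i <= b)%N -> \sum_k v k * 'D_(e k) (iter i vfield f) x = 0.
Proof.
move=> sf Wx A i ib; transitivity (pairing (iter i lie (grad f)) v x).
  by apply: eq_bigr => k _; rewrite iter_lie_grad.
exact: A.
Qed.

End Forms.

(** * Jet spaces and the total derivative *)

Section Jets.
Variables (R : realType) (n m : nat).

Lemma differentiable_mx (V : normedModType R) s t (G : V -> 'M[R]_(s, t)) x :
  (forall i j, differentiable (fun y => G y i j) x) -> differentiable G x.
Proof.
move=> dG.
have -> : G = \sum_i \sum_j (fun y => G y i j *: delta_mx i j).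
  apply/funext => y; rewrite [LHS]matrix_sum_delta fct_sumE; apply: eq_bigr => i _.
  by rewrite fct_sumE.
apply: differentiable_sum => i; apply: differentiable_sum => j.
exact: differentiableZl.
Qed.

(** The coordinates of the jet space: x_i, and u_j^(l) indexed by [(l, j)]. *)
Definition jet_index K : finType := ('I_n + 'I_K.+1 * 'I_m)%type.

Definition jet_dir K (k : jet_index K) : jet R n m K :=
  match k with
  | inl i => (delta_mx 0 i, 0)
  | inr (l, j) => (0, delta_mx l j)
  end.

Definition jet_coord K (k : jet_index K) (p : jet R n m K) : R :=
  match k with inl i => p.1 0 i | inr (l, j) => p.2 l j end.

(** The total derivative, truncated at the highest order so that it becomes a
    vector field on a single jet space: the component along u^(K) is zero. *)
Definition jet_field K (f : 'rV[R]_n -> 'rV[R]_m -> 'rV[R]_n) (k : jet_index K)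
    (p : jet R n m K) : R :=
  match k with
  | inl i => f p.1 (row ord0 p.2) 0 i
  | inr (l, j) => if (l < K)%N then p.2 (inord l.+1) j else 0
  end.

Lemma differentiable_jet_coord K (k : jet_index K) p :
  differentiable (jet_coord k) p.
Proof.
case: k => [i|[l j]].
  apply: (@differentiable_comp _ _ _ _ fst (fun M : 'rV[R]_n => M 0 i)).
    by apply: linear_differentiable; move=> ?; exact: cvg_fst.
  exact: differentiable_coord.
apply: (@differentiable_comp _ _ _ _ snd (fun M : 'M[R]_(K.+1, m) => M l j)).
  by apply: linear_differentiable; move=> ?; exact: cvg_snd.
exact: differentiable_coord.
Qed.

Lemma derive_jet_coordE K (k : jet_index K) v p :
  'D_v (jet_coord k) p = jet_coord k v.
Proof.
have E (t : R) : jet_coord k (t *: v + p) = t * jet_coord k v + jet_coord k p.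
  by case: k => [i|[l j]] /=; rewrite !mxE.
rewrite /derive.
have -> : (fun t : R => t^-1 *: ((jet_coord k \o shift p) (t *: v) -
    jet_coord k p)) = (fun t : R => t^-1 * t * jet_coord k v).
  by apply/funext => t; rewrite /= E addrK /GRing.scale /= mulrA.
apply: lim_near_cst => //; near=> t.
rewrite mulVf ?mul1r //; near: t; exact: nbhs_dnbhs_neq.
Unshelve. all: by end_near. Qed.

Lemma jet_coord_dir K (k k' : jet_index K) :
  jet_coord k' (jet_dir k) = (k == k')%:R.
Proof.
case: k k' => [i|[l j]] [i'|[l' j']] /=; rewrite !mxE ?eqxx //=.
- by rewrite eq_sym.
- by rewrite [inr _ == inr _]/eq_op /= xpair_eqE (eq_sym l') (eq_sym j').
Qed.

Lemma derive_jet_coord K (k k' : jet_index K) p :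
  'D_(jet_dir k) (jet_coord k') p = (k == k')%:R.
Proof. by rewrite derive_jet_coordE jet_coord_dir. Qed.

Lemma smooth_jet_coord K (W : set (jet R n m K)) k : open W ->
  smooth W (jet_coord k).
Proof.
move=> oW [|N].
  by split=> // p _; exact: differentiable_jet_coord.
split=> [p _|v]; first exact: differentiable_jet_coord.
apply: (smooth_upto_ext oW) (smooth_upto_cst oW N (jet_coord k v)) => p _.
by rewrite derive_jet_coordE.
Qed.

Local Notation tr k K := (@jet_trunc R n m k K).

Lemma jet_truncD k K (t : R) (v p : jet R n m K) :
  jet_trunc k (t *: v + p) = t *: jet_trunc k v + jet_trunc k p.
Proof. by congr pair; apply/matrixP => i j; rewrite !mxE. Qed.

Lemma jet_trunc_trunc k l K (p : jet R n m K) : (k <= l)%N ->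
  jet_trunc k (jet_trunc l p) = jet_trunc k p.
Proof.
move=> kl; congr pair; apply/matrixP => i j; rewrite !mxE inordK //.
by rewrite (leq_trans (ltn_ord i)).
Qed.

Lemma differentiable_jet_trunc k K p :
  differentiable (@jet_trunc R n m k K) p.
Proof.
apply: differentiable_pair.
  by apply: linear_differentiable; move=> ?; exact: cvg_fst.
apply: differentiable_mx => i j.
have -> : (fun y : jet R n m K => (\matrix_(l, j) y.2 (inord l) j) i j) =
          jet_coord (inr (inord i, j)) by apply/funext => y; rewrite mxE.
exact: differentiable_jet_coord.
Qed.

Lemma derive_trunc k K (h : jet R n m k -> R) (v p : jet R n m K) :
  'D_v (h \o tr k K) p = 'D_(jet_trunc k v) h (jet_trunc k p).
Proof.
rewrite /derive; set F := fun t : R => _; set G := fun t : R => _.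
suff -> : F = G by [].
by apply/funext => t; rewrite /F /G /= jet_truncD.
Qed.

Lemma jet_trunc_dirx k K i : tr k K (jet_dir (inl i)) = jet_dir (inl i).
Proof. by congr pair; apply/matrixP => a b; rewrite !mxE. Qed.

Lemma jet_trunc_dir_le k K (l : 'I_K.+1) (l' : 'I_k.+1) j : (k <= K)%N ->
  l = l' :> nat -> tr k K (jet_dir (inr (l, j))) = jet_dir (inr (l', j)).
Proof.
move=> kK ll'; congr pair; apply/matrixP => a b; rewrite !mxE; congr ((_ && _)%:R).
rewrite -!val_eqE /= ll' inordK //; exact: leq_trans (ltn_ord a) _.
Qed.

Lemma jet_trunc_dir_gt k K (l : 'I_K.+1) j : (k <= K)%N -> (k < l)%N ->
  tr k K (jet_dir (inr (l, j))) = 0.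
Proof.
move=> kK kl; congr pair; apply/matrixP => a b; rewrite !mxE.
case: eqP => //= al; move: kl; rewrite -al inordK.
  by rewrite ltnNge -ltnS ltn_ord.
exact: leq_trans (ltn_ord a) _.
Qed.

Lemma vfield_trunc f k K (h : jet R n m k -> R) : (k < K)%N ->
  vfield (@jet_dir K) (jet_field f) (h \o tr k K) =
  time_deriv f h \o tr k.+1 K.
Proof.
move=> kK; have kK' : (k <= K)%N by exact: ltnW.
apply/funext => p; rewrite /vfield big_sumType /= /time_deriv.
congr (_ + _).
  apply: eq_bigr => i _; rewrite derive_trunc (jet_trunc_trunc _ (leqnSn k)).
  have -> : row ord0 (tr k.+1 K p).2 = row ord0 p.2.
    by apply/rowP => j; rewrite !mxE; congr (p.2 _ _); apply: val_inj; rewrite /= inordK.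
  by rewrite (@jet_trunc_dirx k K i).
rewrite (eq_bigr (fun lj : 'I_K.+1 * 'I_m => jet_field f (inr (lj.1, lj.2)) p *
   'D_(jet_dir (inr (lj.1, lj.2))) (h \o tr k K) p)); last by case.
rewrite -(pair_big xpredT xpredT (fun l j => jet_field f (inr (l, j)) p *
   'D_(jet_dir (inr (l, j))) (h \o tr k K) p)).
have kK1 : (k.+1 <= K.+1)%N by exact: ltnW.
rewrite (bigID (fun l : 'I_K.+1 => (l < k.+1)%N)) /= [X in _ + X]big1 ?addr0; last first.
  move=> l lk; apply: big1 => j _; rewrite derive_trunc.
  by rewrite (@jet_trunc_dir_gt k K l j) // ?derive0 ?mulr0 // ltnNge.
rewrite (big_ord_narrow kK1); apply: eq_bigr => l _; apply: eq_bigr => j _.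
rewrite derive_trunc (jet_trunc_trunc _ (leqnSn k)).
have lK : (l < K)%N by apply: leq_trans (ltn_ord l) _.
rewrite (@jet_trunc_dir_le k K (widen_ord kK1 l) l j) //= lK mxE.
by congr (p.2 _ _ * _); apply: val_inj.
Qed.

(** As long as no derivative beyond the top order is produced, the truncated
    field computes the iterated time derivatives. *)
Lemma time_derivn_trunc f q b K (h : jet R n m q -> R) : (b + q <= K)%N ->
  iter b (vfield (@jet_dir K) (jet_field f)) (h \o tr q K) =
  time_derivn f h b \o tr (b + q) K.
Proof.
elim: b => [|b IH] bK //=.
by rewrite IH ?vfield_trunc //; exact: ltnW.
Qed.

Lemma smooth_trunc q K (U : set (jet R n m q)) (W : set (jet R n m K)) (h : jet R n m q -> R) :
  (forall p, W p -> U (jet_trunc q p)) -> smooth_on U h ->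
  smooth W (h \o tr q K).
Proof.
move=> WU sh N; elim: N h sh => [|N IH] h sh.
  split=> // p /WU Up; apply: differentiable_comp; last exact: (sh [::]).
  exact: differentiable_jet_trunc.
split=> [p /WU Up|v].
  apply: differentiable_comp; last exact: (sh [::]).
  exact: differentiable_jet_trunc.
have -> : 'D_v (h \o tr q K) = 'D_(jet_trunc q v) h \o tr q K.
  by apply/funext => p; rewrite derive_trunc.
by apply: IH => s x Ux; have := sh (rcons s (jet_trunc q v)) x Ux; rewrite foldr_rcons.
Qed.

Lemma derive_comb (V : normedModType R) (I : finType) (e : I -> V) (v : I -> R)
    (h : V -> R) x : differentiable h x ->
  'D_(\sum_k v k *: e k) h x = \sum_k v k * 'D_(e k) h x.
Proof.
move=> dh; rewrite deriveE // linear_sum; apply: eq_bigr => k _.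
by rewrite linearZ deriveE.
Qed.

Lemma derive_comp_mx0 (V : normedModType R) (W : set V) s t (G : V -> 'M[R]_(s, t))
    (F : 'M[R]_(s, t) -> R) (z : V -> R) v x : open W -> W x ->
  (forall i j, differentiable (fun y => G y i j) x) -> differentiable F (G x) ->
  (forall y, W y -> z y = F (G y)) ->
  (forall i j, 'D_v (fun y => G y i j) x = 0) -> 'D_v z x = 0.
Proof.
move=> oW Wx dG dF zF D0; rewrite (derive_ext oW _ zF Wx).
have dGx := differentiable_mx dG.
rewrite -[fun y => F (G y)]/(F \o G) deriveE; last exact: differentiable_comp.
rewrite diff_comp //= -(deriveE _ dGx) derive_mx; last exact: diff_derivable.
rewrite (_ : \matrix_(i, j) _ = 0) ?linear0 //.
by apply/matrixP => i j; rewrite !mxE D0.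
Qed.

Lemma output_jet_entry f q (phi : 'I_m -> jet R n m q -> R) s K (p : jet R n m K)
    b j : output_jet f phi s p b j =
  time_derivn f (phi j) b (jet_trunc (b + q) p).
Proof. by rewrite mxE. Qed.

(** The infinitesimal content of flatness: a tangent vector along which no
    derivative of the outputs varies changes neither the state nor the input,
    since these are differentiable functions of the derivatives of the outputs.
    The jet order is raised by one so that u' is always among the
    coordinates. *)
Lemma flat_output_kernel f D q (phi : 'I_m -> jet R n m q -> R) :
  (forall K (W : set (jet R n m K)), open W ->
     (forall p, W p -> D (p.1, row ord0 p.2)) ->
     forall k, smooth W (jet_field f k)) ->
  flat_output f D phi -> exists (r K : nat) (W : set (jet R n m K)),
  [/\ (r + q < K)%N, open W, W !=set0 &
   [/\ forall p, W p -> D (p.1, row ord0 p.2),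
       forall j, smooth W (phi j \o tr q K) &
       forall p v, W p ->
       (forall j b, (b <= r)%N -> \sum_k v k *
          'D_(jet_dir k) (iter b (vfield (@jet_dir K) (jet_field f))
                               (phi j \o tr q K)) p = 0) ->
       (forall i, v (inl i) = 0) /\ (forall j, v (inr (ord0, j)) = 0)]].
Proof.
move=> sf [r [W0 [U [Vx [Vu [Fx [Fu [[oW0 [p0 Wp0] oU oVx oVu] sphi sFx sFu H]]]]]]]].
pose K := (r + q).+1; pose W : set (jet R n m K) := tr (r + q) K @^-1` W0.
have rK : (r + q <= K)%N by exact: leqnSn.
have oW : open W.
  apply: open_comp oW0 => p _; apply: differentiable_continuous.
  exact: differentiable_jet_trunc.
have rowE (p : jet R n m K) : row ord0 (tr (r + q) K p).2 = row ord0 p.2.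
  by apply/rowP => j; rewrite !mxE; congr (p.2 _ _); apply: val_inj; rewrite /= inordK.
have sh j : smooth W (phi j \o tr q K).
  apply: smooth_trunc (sphi j) => p /H[_ + _ _ _].
  by rewrite jet_trunc_trunc // leq_addl.
exists r, K, W; split=> //.
  exists ((p0.1, \matrix_(l, j) p0.2 (inord l) j) : jet R n m K).
  rewrite /W /=; suff -> : tr (r + q) K (p0.1, \matrix_(l, j) p0.2 (inord l) j) = p0.
    exact: Wp0.
  case: p0 {Wp0} => a b; congr pair; apply/matrixP => i j; rewrite !mxE inordK.
    by rewrite inord_val.
  by rewrite (ltn_trans (ltn_ord i)).
split=> [p /H[] | // |p v Wp v0]; first by rewrite rowE.
(* The coordinates are recovered as derivatives along [vv]; they factor through
   the output jet, whose derivative along [vv] vanishes. *)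
pose vv := \sum_k v k *: jet_dir k : jet R n m K.
have vE k : 'D_vv (jet_coord k) p = v k.
  rewrite derive_comb; last exact: differentiable_jet_coord.
  rewrite (bigD1 k) //= derive_jet_coord eqxx mulr1 big1 ?addr0 // => k' /negbTE kk'.
  by rewrite derive_jet_coord kk' mulr0.
pose T := vfield (@jet_dir K) (jet_field f).
have entry s b j : (s <= r.+1)%N ->
    (fun y => output_jet f phi s (tr (r + q) K y) b j) =
    iter b T (phi j \o tr q K).
  move=> sr; have br : (b + q <= r + q)%N.
    by rewrite leq_add2r -ltnS (leq_trans (ltn_ord b)).
  rewrite time_derivn_trunc ?(leq_trans br) //.
  by apply/funext => y; rewrite output_jet_entry jet_trunc_trunc.
have WD y : W y -> D (y.1, row ord0 y.2) by move=> /H[]; rewrite rowE.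
have sT b j : smooth W (iter b T (phi j \o tr q K)).
  by elim: b => [|b IH] //=; apply: smooth_vfield => //; exact: sf.
have D0 b j : (b <= r)%N -> 'D_vv (iter b T (phi j \o tr q K)) p = 0.
  by move=> br; rewrite derive_comb ?v0 //; exact: smooth_diff (sT b j) Wp.
have dG s (b : 'I_s) j : (s <= r.+1)%N ->
    differentiable (fun y => output_jet f phi s (tr (r + q) K y) b j) p.
  by move=> sr; rewrite entry //; exact: smooth_diff (sT b j) Wp.
have DG s (b : 'I_s) j : (s <= r.+1)%N ->
    'D_vv (fun y => output_jet f phi s (tr (r + q) K y) b j) p = 0.
  by move=> sr; rewrite entry // D0 // -ltnS (leq_trans (ltn_ord b)).
split=> [i|j].
- rewrite -vE.
  apply: (derive_comp_mx0 (G := fun y => output_jet f phi r (tr (r + q) K y))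
            (F := Fx i) oW Wp) => [b j|||b j].
  + exact: dG (leqnSn r).
  + by have [_ _ [Vxp _] _ _] := H _ Wp; exact: (sFx i [::]).
  + by move=> y /H[_ _ _ /(_ i)].
  + exact: DG (leqnSn r).
- rewrite -vE.
  apply: (derive_comp_mx0 (G := fun y => output_jet f phi r.+1 (tr (r + q) K y))
            (F := Fu j) oW Wp) => [b k|||b k].
  + exact: dG (leqnn _).
  + by have [_ _ [_ Vup] _ _] := H _ Wp; exact: (sFu j [::]).
  + move=> y /H[_ _ _ _ /(_ j) <-]; rewrite /= mxE; congr (y.2 _ _).
    by apply: val_inj; rewrite /= inordK.
  + exact: DG (leqnn _).
Qed.

End Jets.

(** * Forms of order zero and the tangent vectors that they annihilate *)

Section Kernel.
Variables (R : realType) (n K : nat) (W : set (jet R n 2 K)).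
Hypothesis oW : open W.
Variable (f : 'rV[R]_n -> 'rV[R]_2 -> 'rV[R]_n).
Implicit Types (eta zeta chi : jet_index n 2 K -> jet R n 2 K -> R).

Local Notation dir := (@jet_dir R n 2 K).
Local Notation T := (vfield dir (jet_field f)).
Local Notation L := (lie dir (jet_field f)).

Lemma derive_along_cst (V : normedModType R) (h : V -> R) v x :
  (forall t, h (t *: v + x) = h x) -> 'D_v h x = 0.
Proof.
move=> hc; rewrite /derive; apply: lim_near_cst => //; near=> t.
by rewrite /= hc subrr scaler0.
Unshelve. all: by end_near. Qed.

(** Among the components of the total derivative, only the one along u^(l)
    involves u^(l+1). *)
Lemma derive_field_succ (l l' : 'I_K.+1) (j : 'I_2) (k : jet_index n 2 K)
    (x : jet R n 2 K) : l' = l.+1 :> nat ->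
  'D_(dir (inr (l', j))) (jet_field f k) x = (k == inr (l, j))%:R.
Proof.
move=> ll'; case: k => [i|[a b]] /=.
  apply: derive_along_cst => t /=; rewrite scaler0 add0r; congr (f _ _ 0 i).
  apply/rowP => c; rewrite !mxE.
  suff -> : (ord0 == l') = false by rewrite mulr0 add0r.
  by apply/eqP => /(congr1 val); rewrite /= ll'.
have -> : jet_field f (inr (a, b)) =
    if (a < K)%N then @jet_coord R n 2 K (inr (inord a.+1, b)) else cst 0.
  by apply/funext => p /=; case: ifP.
case: ifP => aK; last first.
  rewrite derive_cst; case: eqP => // -[al _].
  by move: (ltn_ord l'); rewrite ll' -al ltnS aK.
rewrite (@derive_jet_coord R n 2 K (inr (l', j)) (inr (inord a.+1, b))).
congr ((nat_of_bool _)%:R); apply/eqP/eqP => -[].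
  move=> /(congr1 val); rewrite /= inordK // ll' => -[la ->].
  by congr (inr (_, _)); apply: val_inj.
move=> -> ->; congr (inr (_, _)); apply: val_inj.
by rewrite /= inordK // -ll'.
Qed.

Lemma lie_input_succ eta (l l' : 'I_K.+1) j x : l' = l.+1 :> nat ->
  L eta (inr (l', j)) x = T (eta (inr (l', j))) x + eta (inr (l, j)) x.
Proof.
move=> ll'; rewrite /lie; congr (_ + _).
rewrite (bigD1 (inr (l, j))) //= (derive_field_succ _ _ _ ll') eqxx mul1r.
rewrite big1 ?addr0 // => k /negbTE kl.
by rewrite (derive_field_succ _ _ _ ll') kl mul0r.
Qed.

(** A form in dx and du only. *)
Definition order0 eta :=
  forall (l : 'I_K.+1) j x, (0 < l)%N -> W x -> eta (inr (l, j)) x = 0.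

(** Each Lie derivative moves the du-part of a form one order up, unchanged. *)
Lemma iter_lie_symbol zeta i : order0 zeta -> (i <= K)%N ->
  (forall (l : 'I_K.+1) j x, (i < l)%N -> W x -> iter i L zeta (inr (l, j)) x = 0) /\
  (forall (l : 'I_K.+1) j x, l = i :> nat -> W x ->
     iter i L zeta (inr (l, j)) x = zeta (inr (ord0, j)) x).
Proof.
move=> z0; elim: i => [|i IH] iK.
  by split=> // l j x l0 Wx; congr (zeta (inr (_, _)) x); exact: val_inj.
have [IH0 IH1] := IH (ltnW iK).
have pred (l : 'I_K.+1) : (0 < l)%N -> exists l' : 'I_K.+1, l = l'.+1 :> nat.
  move=> l0; have lK : (l.-1 < K.+1)%N by exact: leq_ltn_trans (leq_pred l) _.
  by exists (Ordinal lK); rewrite /= prednK.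
split=> l j x li Wx; [have [|l' ll'] := pred l|have [|l' ll'] := pred l].
- exact: leq_ltn_trans li.
- rewrite /= (lie_input_succ _ _ _ ll') (@vfield_cst _ _ _ oW _ _ _ _ 0) //.
  + by rewrite add0r IH0 // -ltnS -ll'.
  + by move=> y Wy; apply: IH0 => //; exact: ltnW.
- by rewrite li.
- rewrite /= (lie_input_succ _ _ _ ll') (@vfield_cst _ _ _ oW _ _ _ _ 0) //.
  + by rewrite add0r IH1 //; apply/eqP; rewrite -eqSS -ll' li.
  + by move=> y Wy; apply: IH0 => //; rewrite li.
Qed.

Lemma solve_2x2 (a b c d y z : R) : a * d - b * c != 0 ->
  exists s t, a * s + b * t = y /\ c * s + d * t = z.
Proof.
move=> D0; exists ((d * y - b * z) / (a * d - b * c)),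
  ((a * z - c * y) / (a * d - b * c)); split; field; exact: D0.
Qed.

(** The determinant of the du-parts of two forms, for two inputs. *)
Definition symbol_det zeta1 zeta2 x :=
  zeta1 (inr (ord0, ord0)) x * zeta2 (inr (ord0, ord_max)) x -
  zeta1 (inr (ord0, ord_max)) x * zeta2 (inr (ord0, ord0)) x.

(** The Lie derivatives of order [b] bring in du^(b) with the invertible matrix
    of du-parts, so the components of [v] along u', u'', ... can be chosen one
    order after the other. *)
Lemma annul_extend zeta1 zeta2 (v0 : jet_index n 2 K -> R) x b :
  order0 zeta1 -> order0 zeta2 -> W x -> symbol_det zeta1 zeta2 x != 0 ->
  pairing zeta1 v0 x = 0 -> pairing zeta2 v0 x = 0 -> (b <= K)%N ->
  exists v, [/\ forall i, v (inl i) = v0 (inl i),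
    forall j, v (inr (ord0, j)) = v0 (inr (ord0, j)),
    annul dir (jet_field f) b zeta1 v x &
    annul dir (jet_field f) b zeta2 v x].
Proof.
move=> o1 o2 Wx D0 z1 z2; elim: b => [|b IH] bK.
  by exists v0; split=> // i; rewrite leqn0 => /eqP ->.
have [v [vx vu a1 a2]] := IH (ltnW bK).
have [s [t [E1 E2]]] := solve_2x2 (- pairing (iter b.+1 L zeta1) v x)
  (- pairing (iter b.+1 L zeta2) v x) D0.
(* The correction along u^(b+1) is not seen by the Lie derivatives of order at
   most [b]. *)
pose l : 'I_K.+1 := Ordinal (bK : (b.+1 < K.+1)%N).
pose v' k := v k + (s * (k == inr (l, ord0))%:R + t * (k == inr (l, ord_max))%:R).
have pv' (eta : jet_index n 2 K -> jet R n 2 K -> R) : pairing eta v' x = pairing eta v x +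
    (eta (inr (l, ord0)) x * s + eta (inr (l, ord_max)) x * t).
  have N1 : (inr (l, ord0) == inr (l, ord_max) :> jet_index n 2 K) = false.
    by apply/eqP => -[].
  have N2 : (inr (l, ord_max) == inr (l, ord0) :> jet_index n 2 K) = false.
    by rewrite eq_sym.
  rewrite /pairing /v'; under eq_bigr do rewrite mulrDl.
  rewrite big_split /=; congr (_ + _).
  rewrite (bigD1 (inr (l, ord0))) //= (bigD1 (inr (l, ord_max))) ?N2 //=.
  rewrite big1 ?addr0 => [|k /andP[/negbTE -> /negbTE ->]]; last by rewrite !mulr0 addr0 mul0r.
  by rewrite N1 !eqxx /=; ring.
have step zeta : order0 zeta -> annul dir (jet_field f) b zeta v x ->
    zeta (inr (ord0, ord0)) x * s + zeta (inr (ord0, ord_max)) x * t =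
    - pairing (iter b.+1 L zeta) v x ->
    annul dir (jet_field f) b.+1 zeta v' x.
  move=> oz az Ez i ib; rewrite pv'.
  have [H0 H1] := iter_lie_symbol oz (leq_trans ib bK).
  move: ib; rewrite leq_eqVlt => /orP[/eqP ib|ib].
    by rewrite !H1 // ib Ez subrr.
  by rewrite !H0 // !mul0r !addr0; exact: az.
exists v'; split; [| |exact: step|exact: step].
- by move=> i; rewrite /v' /= !mulr0 !addr0.
- by move=> j; rewrite /v' /= !mulr0 !addr0.
Qed.

End Kernel.

Section Count.
Variables (R : realType) (K : nat) (W : set (jet R 3 2 K)).
Implicit Types (eta chi : jet_index 3 2 K -> jet R 3 2 K -> R).

(** Four linear equations in the five unknown components along x and u. *)
Lemma four_forms_common_zero (chi : 'I_4 -> jet_index 3 2 K -> jet R 3 2 K -> R) x :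
  W x -> (forall c, order0 W (chi c)) ->
  exists v, ~ ((forall i, v (inl i) = 0) /\ (forall j, v (inr (ord0, j)) = 0)) /\
    forall c, pairing (chi c) v x = 0.
Proof.
move=> Wx ochi.
pose A : 'M[R]_(3 + 2, 4) := \matrix_(k, c)
  match fintype.split k with
  | inl i => chi c (inl i) x | inr j => chi c (inr (ord0, j)) x end.
have rk : (0 < \rank (kermx A))%N.
  by rewrite mxrank_ker subn_gt0 (leq_ltn_trans (rank_leq_col A)).
have [k rk0] : exists k, row k (kermx A) != 0.
  apply/existsP; apply: contraTT rk => /existsPn H; rewrite -leqNgt leqn0 mxrank_eq0.
  by apply/eqP/row_matrixP => i; rewrite row0; apply/eqP; move: (H i); rewrite negbK.
pose a := row k (kermx A).
have aA : a *m A = 0 by rewrite -row_mul mulmx_ker row0.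
pose v (k : jet_index 3 2 K) := match k with
  | inl i => a 0 (lshift 2 i)
  | inr (l, j) => if l == ord0 then a 0 (rshift 3 j) else 0 end.
exists v; split.
  move=> [vx vu]; case/eqP: rk0; apply/rowP => c; rewrite -/a [RHS]mxE.
  by case: (split_ordP c) => i ->; [exact: vx | have := vu i; rewrite /v eqxx].
move=> c; have := congr1 (fun M : 'rV_4 => M 0 c) aA.
rewrite [RHS]mxE => <-; rewrite mxE big_split_ord /= /pairing big_sumType /=.
congr (_ + _).
  by apply: eq_bigr => i _; rewrite [A _ _]mxE (unsplitK (inl i)).
rewrite (eq_bigr (fun lj : 'I_K.+1 * 'I_2 => v (inr (lj.1, lj.2)) *
   chi c (inr (lj.1, lj.2)) x)); last by case.
rewrite -(pair_big xpredT xpredT (fun l j => v (inr (l, j)) * chi c (inr (l, j)) x)).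
rewrite (bigD1 ord0) //= [X in _ + X]big1 ?addr0 => [|l l0].
  by apply: eq_bigr => j _; rewrite [A _ _]mxE (unsplitK (inr j)).
by apply: big1 => j _; rewrite (negbTE l0) mul0r.
Qed.

End Count.

(** * The cone of velocities *)

Lemma sum_ord3 (M : nmodType) (g : 'I_3 -> M) :
  \sum_i g i = g 0 + g 1 + g ord_max.
Proof.
rewrite !big_ord_recl big_ord0 addr0 addrA.
by congr (g _ + g _ + g _); apply: val_inj.
Qed.

Lemma ord3_case (i : 'I_3) : [\/ i = 0, i = 1 | i = ord_max].
Proof.
case: i => -[|[|[|//]]] il; [apply: Or31|apply: Or32|apply: Or33]; exact: val_inj.
Qed.

Section System.
Variables (R : realType) (K : nat).
Local Notation J := (jet R 3 2 K).
Local Notation idx := (jet_index 3 2 K).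
Local Notation dir := (@jet_dir R 3 2 K).
Local Notation fld := (@jet_field R 3 2 K (@sys R)).
Local Notation T := (vfield dir fld).
Local Notation L := (lie dir fld).
Local Notation X0 := (inl 0 : idx).
Local Notation X1 := (inl 1 : idx).
Local Notation X2 := (inl ord_max : idx).
Local Notation U0 := (inr (ord0, ord0) : idx).
Local Notation U1 := (inr (ord0, ord_max) : idx).
Local Notation u0 := (@jet_coord R 3 2 K U0).
Local Notation u1 := (@jet_coord R 3 2 K U1).
Implicit Types (eta zeta chi : idx -> J -> R) (p : J).

(** The parameter of the rulings of the cone. *)
Definition slope p : R := u1 p / u0 p.

Lemma field_X0 : fld X0 = u0.
Proof. by apply/funext => p; rewrite /= /sys !mxE. Qed.

Lemma field_X1 : fld X1 = u1.
Proof.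
apply/funext => p; rewrite /= /sys !mxE /=; congr (p.2 _ _); exact: val_inj.
Qed.

Lemma field_X2 :
  fld X2 = fun p => jet_coord X0 p + u1 p * u1 p * (2 * u0 p)^-1.
Proof.
apply/funext => p; rewrite /= /sys !mxE /= expr2.
by congr (_ + p.2 _ _ * p.2 _ _ / _); exact: val_inj.
Qed.

Lemma field_U (l : 'I_K.+1) j : fld (inr (l, j)) =
  if (l < K)%N then @jet_coord R 3 2 K (inr (inord l.+1, j)) else fun=> 0.
Proof. by apply/funext => p /=; case: ifP. Qed.

Section OnOpen.
Variable W : set J.
Hypotheses (oW : open W) (W0 : forall p, W p -> u0 p != 0).

Let su0 : smooth W u0. Proof. exact: smooth_jet_coord. Qed.
Let su1 : smooth W u1. Proof. exact: smooth_jet_coord. Qed.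
Let sx0 : smooth W (jet_coord X0). Proof. exact: smooth_jet_coord. Qed.

Let s2u0 : smooth W (fun p => (2 * u0 p)^-1).
Proof.
apply: smoothV => // [p Wp|]; first by rewrite mulf_neq0 ?pnatr_eq0 ?W0.
by apply: smoothM => //; exact: smooth_cst.
Qed.

Lemma smooth_field k : smooth W (fld k).
Proof.
case: k => [i|[l j]].
  case: (ord3_case i) => ->; rewrite ?field_X0 ?field_X1 ?field_X2 //.
  by apply: smoothD => //; apply: smoothM => //; exact: smoothM.
rewrite field_U; case: ifP => _; [exact: smooth_jet_coord|exact: smooth_cst].
Qed.

Lemma smooth_slope : smooth W slope.
Proof. by apply: smoothM => //; exact: smoothV. Qed.

Lemma derive_slope k p : W p -> 'D_(dir k) slope p =
  ((k == U1)%:R - slope p * (k == U0)%:R) / u0 p.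
Proof.
move=> Wp; rewrite /slope (deriveM_on _ su1 (smoothV oW W0 su0) Wp).
rewrite (deriveV_on _ su0 Wp (W0 Wp)) !derive_jet_coord; field; exact: W0.
Qed.

Lemma derive_field_X2 k p : W p -> 'D_(dir k) (fld X2) p =
  (k == X0)%:R + slope p * (k == U1)%:R - slope p ^+ 2 / 2 * (k == U0)%:R.
Proof.
move=> Wp; rewrite field_X2.
have h2 : smooth W (fun p => 2 * u0 p) by apply: smoothM => //; exact: smooth_cst.
have n2 : 2 * u0 p != 0 by rewrite mulf_neq0 ?pnatr_eq0 ?W0.
rewrite (deriveD_on _ sx0 (smoothM oW (smoothM oW su1 su1) s2u0) Wp).
rewrite (deriveM_on _ (smoothM oW su1 su1) s2u0 Wp) (deriveM_on _ su1 su1 Wp) (deriveV_on _ h2 Wp n2).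
rewrite (deriveM_on _ (smooth_cst oW 2) su0 Wp) (derive_cst (2 : R)) !derive_jet_coord.
by rewrite /slope; field; exact: W0.
Qed.

(** The partial derivatives of the dynamics: those with respect to u are
    (1, 0, -s^2/2) and (0, 1, s), and the only one with respect to x is the
    drift x_1 of the third equation. *)
Lemma lieE eta k p : W p -> (forall (l : 'I_K.+1) j, (0 < l)%N -> k != inr (l, j)) ->
  L eta k p = T (eta k) p + ((k == U0)%:R * eta X0 p + (k == U1)%:R * eta X1 p +
    ((k == X0)%:R + slope p * (k == U1)%:R - slope p ^+ 2 / 2 * (k == U0)%:R)
      * eta X2 p).
Proof.
move=> Wp k0; rewrite /lie; congr (_ + _); rewrite big_sumType /= sum_ord3.
rewrite [X in _ + X]big1 ?addr0 => [|[l j] _].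
  by rewrite derive_field_X2 // field_X0 field_X1 !derive_jet_coord.
rewrite field_U; case: ifP => lK; last by rewrite (derive_cst (0 : R)) mul0r.
rewrite derive_jet_coord (negbTE (k0 _ _ _)) ?mul0r // inordK //.
Qed.

End OnOpen.
End System.

(** * Derivations of smooth functions *)

Section Derivations.
Variables (R : realType) (V : normedModType R) (W : set V).
Hypothesis oW : open W.
Implicit Types (f g : V -> R) (O : (V -> R) -> V -> R).

(** Partial derivatives and the total derivative are handled alike. *)
Record derivation O : Prop := Derivation {
  der_ext : forall f g, (forall x, W x -> f x = g x) ->
    forall x, W x -> O f x = O g x;
  der_cst : forall c x, W x -> O (fun=> c) x = 0;
  der_D : forall f g x, smooth W f -> smooth W g -> W x ->
    O (fun y => f y + g y) x = O f x + O g x;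
  der_M : forall f g x, smooth W f -> smooth W g -> W x ->
    O (fun y => f y * g y) x = O f x * g x + f x * O g x }.

(** Differentiation as a relation: the rules below build the derivative of an
    explicit formula from those of its atoms. *)
Definition has_der O f f' := smooth W f /\ forall x, W x -> O f x = f' x.

Lemma derivation_derive v : derivation (fun f => 'D_v f).
Proof.
split.
- by move=> f g; exact: derive_ext.
- by move=> c x _; rewrite derive_cst.
- by move=> f g x sf sg; exact: deriveD_on.
- by move=> f g x sf sg; exact: deriveM_on.
Qed.

Lemma derivation_vfield (I : finType) (e : I -> V) tau :
  derivation (vfield e tau).
Proof.
split.
- by move=> f g; exact: vfield_ext.
- by move=> c x Wx; rewrite (@vfield_cst _ _ _ oW _ _ _ _ c).
- by move=> f g x sf sg Wx; exact: vfieldD.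
- by move=> f g x sf sg Wx; exact: (vfieldM e tau sf sg Wx).
Qed.

Variable O : (V -> R) -> V -> R.
Hypothesis dO : derivation O.

Lemma has_der_atom f : smooth W f -> has_der O f (O f).
Proof. by []. Qed.

Lemma has_der_cst c : has_der O (fun=> c) (fun=> 0).
Proof. by split; [exact: smooth_cst|move=> x; exact: der_cst]. Qed.

Lemma has_derD f f' g g' : has_der O f f' -> has_der O g g' ->
  has_der O (fun x => f x + g x) (fun x => f' x + g' x).
Proof.
move=> [sf df] [sg dg]; split=> [|x Wx]; first exact: smoothD.
by rewrite (der_D dO) // df // dg.
Qed.

Lemma has_derM f f' g g' : has_der O f f' -> has_der O g g' ->
  has_der O (fun x => f x * g x) (fun x => f' x * g x + f x * g' x).
Proof.
move=> [sf df] [sg dg]; split=> [|x Wx]; first exact: smoothM.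
by rewrite (der_M dO) // df // dg.
Qed.

Lemma has_derN f f' : has_der O f f' -> has_der O (fun x => - f x) (fun x => - f' x).
Proof.
move=> hf; have [s1 d1] := has_derM (has_der_cst (-1)) hf.
split=> [|x Wx]; first by apply: smoothN => //; case: hf.
rewrite -[RHS]mulN1r -[RHS]add0r -[X in X + _](mul0r (f x)) -d1 //.
by apply: (der_ext dO) => // y _; rewrite mulN1r.
Qed.

Lemma has_der_zero f f' : has_der O f f' -> (forall x, W x -> f x = 0) ->
  forall x, W x -> f' x = 0.
Proof.
move=> [_ df] f0 x Wx; rewrite -df // (der_ext dO (g := fun=> 0)) //.
exact: der_cst.
Qed.

End Derivations.

Ltac has_der_tac oW dO :=
  lazymatch goal with
  | |- has_der _ _ (fun x => _ + _) _ => apply: (has_derD oW dO); has_der_tac oW dO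
  | |- has_der _ _ (fun x => _ * _) _ => apply: (has_derM oW dO); has_der_tac oW dO
  | |- has_der _ _ (fun x => - _) _ => apply: (has_derN oW dO); has_der_tac oW dO
  | |- has_der _ _ _ _ =>
      first [ eassumption
            | apply: (has_der_cst oW dO)
            | apply: has_der_atom; assumption
            | idtac ]
  end.

(** * Identities between values at a point *)

(** The following statements concern the values at one point of the functions
    of the same names in the later parts: [P0] and [P1] are the derivatives of
    phi_1 with respect to u_1 and u_2, [s] is the slope, [iu] is the inverse of
    u_1, [w0], [w1], [w2] and [z0], [z1], [z2] are the components of omega and
    zeta, and [Hij] is the second derivative of phi_1 with respect to the two
    inputs.  The field E is [P0] d/du_2 - [P1] d/du_1. *)
Section PointwiseAlgebra.
Variable R : realType.
Implicit Types P s w z : R.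

Lemma orth_in_frame h0 h1 h1' F A B c1 P0 P1 y :
  h0 * B - h1 * A + F + y = 0 -> F = 0 -> A = c1 * P0 -> B = c1 * P1 -> h1 = h1' ->
  h0 * (c1 * P1) - h1' * (c1 * P0) + y = 0.
Proof. by move=> H hF hA hB hh; rewrite hF hA hB hh addr0 in H. Qed.

(** E annihilates c_1: differentiate the two equations that define c_1 along E,
    and compare with the derivatives of omega(Ef) = 0 with respect to u. *)
Lemma orth_coef_ker P0 P1 s iu w2 c1 k0 k1 H00 H01 H10 H11
    w00 w01 w10 w11 w20 w21 :
  P0 * w01 - P1 * w00 = 0 -> P0 * w11 - P1 * w10 = 0 -> P0 * w21 - P1 * w20 = 0 ->
  H00 * (c1 * P1) - H01 * (c1 * P0) + w2 * (- s * iu) * (P0 + s * P1) = 0 ->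
  H01 * (c1 * P1) - H11 * (c1 * P0) + w2 * iu * (P0 + s * P1) = 0 ->
  w00 - s * (- s * iu) * w2 - s * s * 2^-1 * w20 = k0 * P0 + c1 * H00 ->
  w01 - s * iu * w2 - s * s * 2^-1 * w21 = k1 * P0 + c1 * H01 ->
  w10 + - s * iu * w2 + s * w20 = k0 * P1 + c1 * H10 ->
  w11 + iu * w2 + s * w21 = k1 * P1 + c1 * H11 -> H10 = H01 ->
  (P0 != 0) || (P1 != 0) -> P0 * k1 - P1 * k0 = 0.
Proof.
move=> E0 E1 E2 I0 I1 C00 C01 C10 C11 HH P; rewrite HH in C10.
have h0 : P0 * (P0 * k1 - P1 * k0) = 0.
  transitivity (P0 * (k1 * P0 + c1 * H01) - P1 * (k0 * P0 + c1 * H00) -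
    c1 * (P0 * H01 - P1 * H00)); first by ring.
  rewrite -C01 -C00.
  transitivity ((P0 * w01 - P1 * w00) - s * s * 2^-1 * (P0 * w21 - P1 * w20) +
    (H00 * (c1 * P1) - H01 * (c1 * P0) + w2 * (- s * iu) * (P0 + s * P1))).
    by field.
  by rewrite E0 E2 I0 mulr0 subr0 addr0.
have h1 : P1 * (P0 * k1 - P1 * k0) = 0.
  transitivity (P0 * (k1 * P1 + c1 * H11) - P1 * (k0 * P1 + c1 * H01) -
    c1 * (P0 * H11 - P1 * H01)); first by ring.
  rewrite -C11 -C10.
  transitivity ((P0 * w11 - P1 * w10) + s * (P0 * w21 - P1 * w20) +
    (H01 * (c1 * P1) - H11 * (c1 * P0) + w2 * iu * (P0 + s * P1))); first by ring.
  by rewrite E1 E2 I1 mulr0 !addr0.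
by case/orP: P => /negbTE P; apply/eqP; move/eqP: h0; move/eqP: h1;
  rewrite !mulf_eq0 P.
Qed.

(** The first hypothesis is the derivative of the Jacobian determinant in u
    along a coordinate; [a0], [a1], [g0], [g1] are the same second derivatives
    of phi_1 and phi_2, taken in the other order. *)
Lemma ker_transfer P0 P1 Q0 Q1 c P0k P1k Q0k Q1k a0 a1 g0 g1 :
  P0k * Q1 + P0 * Q1k - (P1k * Q0 + P1 * Q0k) = 0 ->
  Q0 = c * P0 -> Q1 = c * P1 -> P0k = a0 -> P1k = a1 -> Q0k = g0 -> Q1k = g1 ->
  P0 * g1 - P1 * g0 = c * (P0 * a1 - P1 * a0).
Proof.
move=> H q0 q1 <- <- <- <-; rewrite q0 q1 in H.
apply/eqP; rewrite -subr_eq0 -H; apply/eqP; ring.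
Qed.

Lemma ker_coef P0 P1 c c0 c1 Q00 Q01 Q10 Q11 P00 P01 P10 P11 :
  Q00 = c0 * P0 + c * P00 -> Q01 = c1 * P0 + c * P01 ->
  Q10 = c0 * P1 + c * P10 -> Q11 = c1 * P1 + c * P11 ->
  P0 * Q01 - P1 * Q00 = c * (P0 * P01 - P1 * P00) ->
  P0 * Q11 - P1 * Q10 = c * (P0 * P11 - P1 * P10) ->
  (P0 != 0) || (P1 != 0) -> P0 * c1 - P1 * c0 = 0.
Proof.
move=> -> -> -> -> /eqP; rewrite -subr_eq0.
set e0 := (X in X == 0) => /eqP E0 /eqP; rewrite -subr_eq0.
set e1 := (X in X == 0) => /eqP E1 P.
have h0 : P0 * (P0 * c1 - P1 * c0) = 0 by rewrite -E0 /e0; ring.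
have h1 : P1 * (P0 * c1 - P1 * c0) = 0 by rewrite -E1 /e1; ring.
by case/orP: P => /negbTE P; apply/eqP; move/eqP: h0; move/eqP: h1;
  rewrite !mulf_eq0 P.
Qed.

Lemma ker_sub_mul P0 P1 c c0 c1 a a0 a1 g0 g1 w0 w1 :
  w0 = g0 - (c0 * a + c * a0) -> w1 = g1 - (c1 * a + c * a1) ->
  P0 * g1 - P1 * g0 = c * (P0 * a1 - P1 * a0) -> P0 * c1 - P1 * c0 = 0 ->
  P0 * w1 - P1 * w0 = 0.
Proof.
move=> -> -> /eqP; rewrite -subr_eq0; set e := (X in X == 0) => /eqP E.
set f := (X in X = 0) => F; transitivity (e - a * f); last by rewrite E F mulr0 subr0.
by rewrite /e /f; ring.
Qed.

Lemma nor_neq0 (a b : R) : ~ ((a != 0) || (b != 0)) -> a = 0 /\ b = 0.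
Proof. by move=> /negP; rewrite negb_or !negbK => /andP[/eqP -> /eqP ->]. Qed.

Lemma sqr_sum3_eq0 (a b c : R) : a * a + b * b + c * c = 0 ->
  [/\ a = 0, b = 0 & c = 0].
Proof.
move=> n0; have := sqr_ge0 a; have := sqr_ge0 b; have := sqr_ge0 c.
rewrite !expr2 => c0 b0 a0; split; apply/eqP; rewrite -[_ == 0]orbb -mulf_eq0;
  apply/eqP; lra.
Qed.

Lemma sqr_sum3_0 (a b c : R) : a = 0 -> b = 0 -> c = 0 ->
  a * a + b * b + c * c = 0.
Proof. by move=> -> -> ->; rewrite mulr0 !addr0. Qed.

Lemma parallel2 (a0 a1 g0 g1 : R) : a0 * g1 - a1 * g0 = 0 ->
  let n := a0 * a0 + a1 * a1 in n != 0 -> let c := (a0 * g0 + a1 * g1) / n in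
  g0 = c * a0 /\ g1 = c * a1.
Proof.
move=> E n n0 c; have nc : n * c = a0 * g0 + a1 * g1.
  by rewrite /c mulrCA mulfV // mulr1.
split; apply: (mulfI n0); rewrite mulrA nc; apply/eqP; rewrite -subr_eq0; apply/eqP.
- transitivity (- a1 * (a0 * g1 - a1 * g0)); first by rewrite /n; ring.
  by rewrite E mulr0.
- transitivity (a0 * (a0 * g1 - a1 * g0)); first by rewrite /n; ring.
  by rewrite E mulr0.
Qed.

Lemma parallel3 (a0 a1 a2 g0 g1 g2 : R) :
  a0 * g1 - a1 * g0 = 0 -> a0 * g2 - a2 * g0 = 0 -> a1 * g2 - a2 * g1 = 0 ->
  let n := a0 * a0 + a1 * a1 + a2 * a2 in n != 0 ->
  let c := (a0 * g0 + a1 * g1 + a2 * g2) * n^-1 in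
  [/\ g0 - c * a0 = 0, g1 - c * a1 = 0 & g2 - c * a2 = 0].
Proof.
move=> E0 E1 E2 n n0 c; have nc : n * c = a0 * g0 + a1 * g1 + a2 * g2.
  by rewrite /c mulrCA mulfV // mulr1.
split; apply: (mulfI n0); rewrite mulr0 mulrBr mulrA nc.
- transitivity (- a1 * (a0 * g1 - a1 * g0) - a2 * (a0 * g2 - a2 * g0)).
    by rewrite /n; ring.
  by rewrite E0 E1 !mulr0 subr0.
- transitivity (a0 * (a0 * g1 - a1 * g0) - a2 * (a1 * g2 - a2 * g1)).
    by rewrite /n; ring.
  by rewrite E0 E2 !mulr0 subr0.
- transitivity (a0 * (a0 * g2 - a2 * g0) + a1 * (a1 * g2 - a2 * g1)).
    by rewrite /n; ring.
  by rewrite E1 E2 !mulr0 addr0.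
Qed.

(** Both [g] and [h] are orthogonal to the plane spanned by [w] and [z]. *)
Lemma cross_orthogonal (w0 w1 w2 z0 z1 z2 g0 g1 g2 h0 h1 h2 : R) :
  w0 * g0 + w1 * g1 + w2 * g2 = 0 -> z0 * g0 + z1 * g1 + z2 * g2 = 0 ->
  w0 * h0 + w1 * h1 + w2 * h2 = 0 -> z0 * h0 + z1 * h1 + z2 * h2 = 0 ->
  ~ [/\ w0 * z1 - w1 * z0 = 0, w0 * z2 - w2 * z0 = 0 & w1 * z2 - w2 * z1 = 0] ->
  [/\ g0 * h1 - g1 * h0 = 0, g0 * h2 - g2 * h0 = 0 & g1 * h2 - g2 * h1 = 0].
Proof.
move=> wg zg wh zh ncross.
pose n0 := g1 * h2 - g2 * h1; pose n1 := g2 * h0 - g0 * h2; pose n2 := g0 * h1 - g1 * h0.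
have par (a0 a1 a2 : R) : a0 * g0 + a1 * g1 + a2 * g2 = 0 ->
    a0 * h0 + a1 * h1 + a2 * h2 = 0 ->
    [/\ a0 * n1 = a1 * n0, a0 * n2 = a2 * n0 & a1 * n2 = a2 * n1].
  move=> ag ah; split; apply/eqP; rewrite -subr_eq0.
  - have -> : a0 * n1 - a1 * n0 = g2 * (a0 * h0 + a1 * h1 + a2 * h2) -
        h2 * (a0 * g0 + a1 * g1 + a2 * g2) by rewrite /n0 /n1; ring.
    by rewrite ag ah !mulr0 subr0.
  - have -> : a0 * n2 - a2 * n0 = h1 * (a0 * g0 + a1 * g1 + a2 * g2) -
        g1 * (a0 * h0 + a1 * h1 + a2 * h2) by rewrite /n0 /n2; ring.
    by rewrite ag ah !mulr0 subr0.
  - have -> : a1 * n2 - a2 * n1 = g0 * (a0 * h0 + a1 * h1 + a2 * h2) -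
        h0 * (a0 * g0 + a1 * g1 + a2 * g2) by rewrite /n1 /n2; ring.
    by rewrite ag ah !mulr0 subr0.
have [w01 w02 w12] := par _ _ _ wg wh; have [z01 z02 z12] := par _ _ _ zg zh.
have key (n x : R) : n * n * x = 0 -> n != 0 -> x = 0.
  by move=> /eqP; rewrite !mulf_eq0 orbb => /orP[/eqP -> /eqP|/eqP].
have [n0E|n0N] := eqVneq n0 0; last first.
  case: ncross; split; apply: (key n0) => //.
  - have -> : n0 * n0 * (w0 * z1 - w1 * z0) =
      w0 * n0 * (z1 * n0) - (w1 * n0) * (z0 * n0) by ring.
    by rewrite -w01 -z01; ring.
  - have -> : n0 * n0 * (w0 * z2 - w2 * z0) =
      w0 * n0 * (z2 * n0) - (w2 * n0) * (z0 * n0) by ring.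
    by rewrite -w02 -z02; ring.
  - have -> : n0 * n0 * (w1 * z2 - w2 * z1) =
      w1 * n0 * (z2 * n0) - (w2 * n0) * (z1 * n0) by ring.
    by rewrite -w02 -z02 -w01 -z01; ring.
have [n1E|n1N] := eqVneq n1 0; last first.
  case: ncross; split; apply: (key n1) => //.
  - have -> : n1 * n1 * (w0 * z1 - w1 * z0) =
      w0 * n1 * (z1 * n1) - (w1 * n1) * (z0 * n1) by ring.
    by rewrite w01 z01; ring.
  - have -> : n1 * n1 * (w0 * z2 - w2 * z0) =
      w0 * n1 * (z2 * n1) - (w2 * n1) * (z0 * n1) by ring.
    by rewrite -w12 -z12 w01 z01; ring.
  - have -> : n1 * n1 * (w1 * z2 - w2 * z1) =
      w1 * n1 * (z2 * n1) - (w2 * n1) * (z1 * n1) by ring.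
    by rewrite -w12 -z12; ring.
have [n2E|n2N] := eqVneq n2 0; last first.
  case: ncross; split; apply: (key n2) => //.
  - have -> : n2 * n2 * (w0 * z1 - w1 * z0) =
      w0 * n2 * (z1 * n2) - (w1 * n2) * (z0 * n2) by ring.
    by rewrite w02 z02 w12 z12; ring.
  - have -> : n2 * n2 * (w0 * z2 - w2 * z0) =
      w0 * n2 * (z2 * n2) - (w2 * n2) * (z0 * n2) by ring.
    by rewrite w02 z02; ring.
  - have -> : n2 * n2 * (w1 * z2 - w2 * z1) =
      w1 * n2 * (z2 * n2) - (w2 * n2) * (z1 * n2) by ring.
    by rewrite w12 z12; ring.
split=> //; apply/eqP; rewrite -oppr_eq0 opprB; apply/eqP; exact: n1E.
Qed.

(** The contraction of E(zeta) with Ef vanishes.  Here [Mjk] is the mixed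
    second derivative of phi_1 in u_j and x_k, [gik] the derivative of omega_i
    in x_k, [ai] and [bi] those of omega_i in u_1 and u_2, and [ei] is
    E(zeta_i). *)
Lemma orth_zeta_ker P0 P1 s c1 T0 T1 M00 M01 M02 M10 M11 M12
    g00 g01 g02 g10 g11 g12 g20 g21 g22 a0 a1 a2 b0 b1 b2 e0 e1 e2 :
  c1 * (M00 * P1 - M10 * P0) +
    (P0 * (g10 + s * g20) - P1 * (g00 - s * s * 2^-1 * g20)) = 0 ->
  c1 * (M01 * P1 - M11 * P0) +
    (P0 * (g11 + s * g21) - P1 * (g01 - s * s * 2^-1 * g21)) = 0 ->
  c1 * (M02 * P1 - M12 * P0) +
    (P0 * (g12 + s * g22) - P1 * (g02 - s * s * 2^-1 * g22)) = 0 ->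
  P0 * (a1 + s * a2) - P1 * (a0 - s * s * 2^-1 * a2) = 0 ->
  P0 * (b1 + s * b2) - P1 * (b0 - s * s * 2^-1 * b2) = 0 ->
  e0 = P0 * (g01 + s * g02) - P1 * (g00 - s * s * 2^-1 * g02) -
       (T0 * b0 - T1 * a0) - c1 * (P0 * M10 - P1 * M00) ->
  e1 = P0 * (g11 + s * g12) - P1 * (g10 - s * s * 2^-1 * g12) -
       (T0 * b1 - T1 * a1) - c1 * (P0 * M11 - P1 * M01) ->
  e2 = P0 * (g21 + s * g22) - P1 * (g20 - s * s * 2^-1 * g22) -
       (T0 * b2 - T1 * a2) - c1 * (P0 * M12 - P1 * M02) ->
  P0 * (e1 + s * e2) - P1 * (e0 - s * s * 2^-1 * e2) = 0.
Proof.
set h0 := (X in X = 0 -> _) => H0; set h1 := (X in X = 0 -> _) => H1.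
set h2 := (X in X = 0 -> _) => H2; set f0 := (X in X = 0 -> _) => F0.
set f1 := (X in X = 0 -> _) => F1 -> -> ->.
transitivity (- P1 * h0 + P0 * h1 + (s * P0 + s * s * 2^-1 * P1) * h2
              - T0 * f1 + T1 * f0).
  by rewrite /h0 /h1 /h2 /f0 /f1; field.
by rewrite H0 H1 H2 F0 F1 !mulr0 !addr0 subr0.
Qed.

(** The forms omega and zeta annihilate Ef and EEf, so these vectors are
    parallel.  On the cone, the components of their cross product are
    multiples of the square of [P0 + s * P1], which vanishes exactly when E
    points along the ruling. *)
Lemma straight_line_is_ruling P0 P1 s iu c1 H00 H01 H11 w0 w1 w2 z0 z1 z2 v0 v1 v2
    x0 x1 x2 :
  P0 * (w1 + s * w2) - P1 * (w0 - s * s * 2^-1 * w2) = 0 ->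
  P0 * (z1 + s * z2) - P1 * (z0 - s * s * 2^-1 * z2) = 0 ->
  w0 - s * s * 2^-1 * w2 = c1 * P0 -> w1 + s * w2 = c1 * P1 ->
  H00 * (c1 * P1) - H01 * (c1 * P0) + w2 * (- s * iu) * (P0 + s * P1) = 0 ->
  H01 * (c1 * P1) - H11 * (c1 * P0) + w2 * iu * (P0 + s * P1) = 0 ->
  H00 * (z1 + s * z2) - H01 * (z0 - s * s * 2^-1 * z2) +
    (P0 * (v1 + s * v2) - P1 * (v0 - s * s * 2^-1 * v2)) +
    z2 * (- s * iu) * (P0 + s * P1) = 0 ->
  H01 * (z1 + s * z2) - H11 * (z0 - s * s * 2^-1 * z2) +
    (P0 * (x1 + s * x2) - P1 * (x0 - s * s * 2^-1 * x2)) +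
    z2 * iu * (P0 + s * P1) = 0 ->
  P0 * ((P0 * x1 - P1 * v1) + s * (P0 * x2 - P1 * v2)) -
  P1 * ((P0 * x0 - P1 * v0) - s * s * 2^-1 * (P0 * x2 - P1 * v2)) = 0 ->
  ~ [/\ w0 * z1 - w1 * z0 = 0, w0 * z2 - w2 * z0 = 0 & w1 * z2 - w2 * z1 = 0] ->
  (P0 != 0) || (P1 != 0) -> iu != 0 -> P0 + s * P1 = 0.
Proof.
move=> wG zG c10 c11 wU0 wU1 zU0 zU1 zE ncross P iu0.
(* [q0] and [q1] are E(P0) and E(P1); since E(s) = iu * t, the vector EEf is
   (- q1, q0, s * q0 + s^2/2 * q1 + iu * t^2). *)
pose q0 := P0 * H01 - P1 * H00; pose q1 := P0 * H11 - P1 * H01.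
pose t := P0 + s * P1.
have wEG : w0 * (- q1) + w1 * q0 + w2 * (s * q0 + s * s * 2^-1 * q1 + iu * t * t) = 0.
  transitivity ((w1 + s * w2) * q0 - (w0 - s * s * 2^-1 * w2) * q1 + w2 * (iu * t * t)).
    by field.
  rewrite c10 c11; transitivity (P0 * (H01 * (c1 * P1) - H11 * (c1 * P0) +
    w2 * iu * (P0 + s * P1)) - P1 * (H00 * (c1 * P1) - H01 * (c1 * P0) +
    w2 * (- s * iu) * (P0 + s * P1))); first by rewrite /q0 /q1 /t; ring.
  by rewrite wU0 wU1 !mulr0 subr0.
have zEG : z0 * (- q1) + z1 * q0 + z2 * (s * q0 + s * s * 2^-1 * q1 + iu * t * t) = 0.
  move: zU0 zU1 zE; set l0 := (X in X = 0 -> _) => L0.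
  set l1 := (X in X = 0 -> _) => L1; set l2 := (X in X = 0 -> _) => L2.
  transitivity (P0 * l1 - P1 * l0 - l2); last by rewrite L0 L1 L2 !mulr0 !subr0.
  by rewrite /l0 /l1 /l2 /q0 /q1 /t; field.
have wG' : w0 * (- P1) + w1 * P0 + w2 * (s * P0 + s * s * 2^-1 * P1) = 0.
  by rewrite -wG; field.
have zG' : z0 * (- P1) + z1 * P0 + z2 * (s * P0 + s * s * 2^-1 * P1) = 0.
  by rewrite -zG; field.
have [C01 C02 C12] := cross_orthogonal wG' zG' wEG zEG ncross.
have k0 : P1 * iu * (t * t) = 0.
  transitivity (s * (- P1 * q0 - P0 * - q1) - (- P1 * (s * q0 + s * s * 2^-1 * q1 +
    iu * t * t) - (s * P0 + s * s * 2^-1 * P1) * - q1)); first by field.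
  by rewrite C01 C02 mulr0 subr0.
have k1 : P0 * iu * (t * t) = 0.
  transitivity (P0 * (s * q0 + s * s * 2^-1 * q1 + iu * t * t) -
    (s * P0 + s * s * 2^-1 * P1) * q0 - s * s * 2^-1 * (- P1 * q0 - P0 * - q1)).
    by field.
  by rewrite C01 C12 mulr0 subr0.
by case/orP: P => /negbTE P; apply/eqP; move/eqP: k0; move/eqP: k1;
  rewrite !mulf_eq0 (negbTE iu0) P /= orbb.
Qed.

(** With E along the ruling, zeta(Ef) is, up to the factor [- P1], the
    derivative of the relation omega(Ef) = 0 plus the drift term [w2]. *)
Lemma ruling_conormal_eq0 P0 P0' P1 P1' s ds c1 w2 t0 t1 t2 z0 z1 z2 a0 a1 a2 :
  P0 * (z1 + s * z2) - P1 * (z0 - s * s * 2^-1 * z2) = 0 ->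
  z0 = t0 + w2 - c1 * a0 -> z1 = t1 - c1 * a1 -> z2 = t2 - c1 * a2 ->
  t0 - s * ds * w2 - s * s * 2^-1 * t2 = 0 * P0 + 0 * P0' ->
  t1 + ds * w2 + s * t2 = 0 * P1 + 0 * P1' ->
  P0 + s * P1 = 0 -> c1 = 0 -> P1 != 0 -> w2 = 0.
Proof.
move=> H z0E z1E z2E H1 H2 /eqP; rewrite addr_eq0 => /eqP P0E c10 P1_neq0.
rewrite z0E z1E z2E P0E c10 in H; rewrite !mul0r addr0 in H1 H2.
move: H H1 H2 P1_neq0.
(* [e1] and [e2] are the derivatives along T of the two relations that express
   that omega is conormal to the cone. *)
set e3 := (X in X = 0 -> _) => E3; set e1 := (X in X = 0 -> _) => E1.
set e2 := (X in X = 0 -> _) => E2 /negbTE P; apply/eqP.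
have /eqP : P1 * w2 = 0.
  transitivity (- e3 - P1 * e1 - P1 * s * e2); last first.
    by rewrite E1 E2 E3 !mulr0 !oppr0 !addr0.
  by rewrite /e1 /e2 /e3; field.
by rewrite mulf_eq0 P.
Qed.

End PointwiseAlgebra.

(** * Identities obtained by differentiation *)

(** With [P0], [P1], [s] as above, [P0 * (w1 + s * w2) - P1 * (w0 - s^2/2 * w2)]
    is the contraction with Ef of the form with components [w0], [w1], [w2];
    the two factors in parentheses are its contractions with the derivatives
    of f with respect to u_2 and u_1. *)
Section DifferentiatedIdentities.
Variables (R : realType) (V : normedModType R) (W : set V).
Hypothesis oW : open W.
Variable O : (V -> R) -> V -> R.
Hypothesis dO : derivation W O.
Variables (s s' P0 P0' P1 P1' w0 w0' w1 w1' w2 w2' : V -> R).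
Hypotheses (Os : has_der W O s s') (OP0 : has_der W O P0 P0')
  (OP1 : has_der W O P1 P1') (Ow0 : has_der W O w0 w0')
  (Ow1 : has_der W O w1 w1') (Ow2 : has_der W O w2 w2').

Lemma der_identity f g f' g' : has_der W O f f' -> has_der W O g g' ->
  (forall x, W x -> f x = g x) -> forall x, W x -> f' x = g' x.
Proof.
by move=> [_ df] [_ dg] fg x Wx; rewrite -df // -dg //; exact: (der_ext dO).
Qed.

Lemma der_orth :
  (forall x, W x -> P0 x * (w1 x + s x * w2 x) -
                    P1 x * (w0 x - s x * s x * 2^-1 * w2 x) = 0) ->
  forall x, W x ->
    P0' x * (w1 x + s x * w2 x) - P1' x * (w0 x - s x * s x * 2^-1 * w2 x) +
    (P0 x * (w1' x + s x * w2' x) - P1 x * (w0' x - s x * s x * 2^-1 * w2' x)) +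
    w2 x * s' x * (P0 x + s x * P1 x) = 0.
Proof.
move=> H x Wx; apply: etrans (has_der_zero dO _ H Wx); last first.
  by has_der_tac oW dO.
by cbv beta; field.
Qed.

Lemma der_orth_x c1 c1' :
  has_der W O c1 c1' ->
  (forall x, W x -> w0 x - s x * s x * 2^-1 * w2 x = c1 x * P0 x) ->
  forall x, W x ->
    w0' x - s x * s' x * w2 x - s x * s x * 2^-1 * w2' x =
    c1' x * P0 x + c1 x * P0' x.
Proof.
move=> Oc1 H x Wx.
have hl : has_der W O (fun x => w0 x - s x * s x * 2^-1 * w2 x)
  (fun x => w0' x - (((s' x * s x + s x * s' x) * 2^-1 + s x * s x * 0) * w2 x +
                     s x * s x * 2^-1 * w2' x)) by has_der_tac oW dO.
have hr := has_derM oW dO Oc1 OP0.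
by have := der_identity hl hr H Wx; cbv beta => <-; field.
Qed.

Lemma has_der_orth0 :
  (forall x, W x -> s' x = 0) -> (forall x, W x -> w0' x = 0) ->
  (forall x, W x -> w1' x = 0) -> (forall x, W x -> w2' x = 0) ->
  has_der W O (fun x => w0 x - s x * s x * 2^-1 * w2 x) (fun=> 0) /\
  has_der W O (fun x => w1 x + s x * w2 x) (fun=> 0).
Proof.
move=> s0 w00 w10 w20; split.
  have : has_der W O (fun x => w0 x - s x * s x * 2^-1 * w2 x)
  (fun x => w0' x - (((s' x * s x + s x * s' x) * 2^-1 + s x * s x * 0) * w2 x +
                     s x * s x * 2^-1 * w2' x)) by has_der_tac oW dO.
  by move=> [sH H]; split=> // x Wx; rewrite H // s0 // w00 // w20 //; ring.
have [sH H] := has_derD oW dO Ow1 (has_derM oW dO Os Ow2).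
by split=> // x Wx; rewrite H // s0 // w10 // w20 //; ring.
Qed.

Lemma der_orth_y c1 c1' :
  has_der W O c1 c1' ->
  (forall x, W x -> w1 x + s x * w2 x = c1 x * P1 x) ->
  forall x, W x ->
    w1' x + s' x * w2 x + s x * w2' x = c1' x * P1 x + c1 x * P1' x.
Proof.
move=> Oc1 H x Wx; rewrite -addrA.
exact: (der_identity (has_derD oW dO Ow1 (has_derM oW dO Os Ow2))
                     (has_derM oW dO Oc1 OP1) H Wx).
Qed.

Lemma der_sub_mul z z' t t' c1 c1' a a' : has_der W O z z' -> has_der W O t t' ->
  has_der W O c1 c1' -> has_der W O a a' ->
  (forall x, W x -> z x = t x - c1 x * a x) -> forall x, W x ->
  z' x = t' x - (c1' x * a x + c1 x * a' x).
Proof.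
move=> Oz Ot Oc1 Oa H x Wx.
exact: (der_identity Oz
          (has_derD oW dO Ot (has_derN oW dO (has_derM oW dO Oc1 Oa))) H Wx).
Qed.

Lemma der_ker a a' b b' : has_der W O a a' -> has_der W O b b' ->
  (forall x, W x -> P0 x * b x - P1 x * a x = 0) -> forall x, W x ->
  P0' x * b x + P0 x * b' x - (P1' x * a x + P1 x * a' x) = 0.
Proof.
move=> Oa Ob H x Wx.
exact: (has_der_zero dO (has_derD oW dO (has_derM oW dO OP0 Ob)
                           (has_derN oW dO (has_derM oW dO OP1 Oa))) H Wx).
Qed.

Lemma der_coef_eq0 c c' q0 q1 : has_der W O c c' ->
  has_der W O q0 (fun=> 0) -> has_der W O q1 (fun=> 0) ->
  (forall x, W x -> P0' x = 0) -> (forall x, W x -> P1' x = 0) ->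
  (forall x, W x -> (P0 x != 0) || (P1 x != 0)) ->
  (forall x, W x -> q0 x = c x * P0 x) -> (forall x, W x -> q1 x = c x * P1 x) ->
  forall x, W x -> c' x = 0.
Proof.
move=> Oc O0 O1 P00 P10 P_neq0 H0 H1 x Wx.
have := der_identity O0 (has_derM oW dO Oc OP0) H0 Wx.
have := der_identity O1 (has_derM oW dO Oc OP1) H1 Wx.
cbv beta; rewrite P00 // P10 // !mulr0 !addr0 => /esym/eqP + /esym/eqP.
by rewrite !mulf_eq0; case/orP: (P_neq0 x Wx) => /negbTE ->; rewrite !orbF => /eqP + /eqP.
Qed.

End DifferentiatedIdentities.

(** * Covectors that do not depend on the input *)

(** The conormals (s^2/2, -s, 1) of the cone span the space as s varies:
    relations between covectors independent of u that hold along the cone can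
    be differentiated with respect to u_2, which only acts on s. *)
Section Cone.
Variables (R : realType) (V : normedModType R) (W : set V).
Hypothesis oW : open W.
Variable O : (V -> R) -> V -> R.
Hypothesis dO : derivation W O.
Variables (s iu a0 a1 a2 g0 g1 g2 : V -> R).
Hypotheses (Os : has_der W O s iu) (iu0 : forall x, W x -> iu x != 0).
Hypotheses (Oa0 : has_der W O a0 (fun=> 0)) (Oa1 : has_der W O a1 (fun=> 0))
  (Oa2 : has_der W O a2 (fun=> 0)) (Og0 : has_der W O g0 (fun=> 0))
  (Og1 : has_der W O g1 (fun=> 0)) (Og2 : has_der W O g2 (fun=> 0)).

Lemma cone_conormal :
  (forall x, W x -> a0 x - s x * s x * 2^-1 * a2 x = 0) ->
  (forall x, W x -> a1 x + s x * a2 x = 0) ->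
  forall x, W x -> [/\ a0 x = 0, a1 x = 0 & a2 x = 0].
Proof.
move=> H0 H1.
have a20 x : W x -> a2 x = 0.
  move=> Wx; have := has_der_zero dO (has_derD oW dO Oa1 (has_derM oW dO Os Oa2)) H1 Wx.
  cbv beta; rewrite add0r mulr0 addr0 => /eqP.
  by rewrite mulf_eq0 (negbTE (iu0 Wx)) => /eqP.
move=> x Wx; have := H0 x Wx; have := H1 x Wx.
by rewrite (a20 x Wx) !mulr0 addr0 subr0.
Qed.

Lemma cone_minors :
  (forall x, W x ->
     (a0 x - s x * s x * 2^-1 * a2 x) * (g1 x + s x * g2 x) -
     (a1 x + s x * a2 x) * (g0 x - s x * s x * 2^-1 * g2 x) = 0) ->
  forall x, W x -> [/\ a0 x * g1 x - a1 x * g0 x = 0,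
    a0 x * g2 x - a2 x * g0 x = 0 & a1 x * g2 x - a2 x * g1 x = 0].
Proof.
move=> H.
(* The determinant is quadratic in s; [H1] and [H2] are its first and second
   derivatives, divided by that of s. *)
have H1 x : W x -> (a0 x * g2 x - a2 x * g0 x) +
    s x * (a1 x * g2 x - a2 x * g1 x) = 0.
  move=> Wx; apply: (mulIf (iu0 Wx)); rewrite mul0r.
  apply: etrans (has_der_zero dO _ H Wx); last first.
    by has_der_tac oW dO.
  by cbv beta; field.
have H2 x : W x -> a1 x * g2 x - a2 x * g1 x = 0.
  move=> Wx; apply: (mulIf (iu0 Wx)); rewrite mul0r.
  apply: etrans (has_der_zero dO _ H1 Wx); last first.
    by has_der_tac oW dO.
  by cbv beta; ring.
move=> x Wx; have E2 := H2 x Wx; have := H1 x Wx; rewrite E2 mulr0 addr0 => E1.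
split=> //; rewrite -(H x Wx).
transitivity ((a0 x * g1 x - a1 x * g0 x) + s x * (a0 x * g2 x - a2 x * g0 x) +
  s x * s x * 2^-1 * (a1 x * g2 x - a2 x * g1 x)); last by field.
by rewrite E1 E2 !mulr0 !addr0.
Qed.

End Cone.

(** Replaces all values at [p] by variables, so that [ring] and [field] do not
    try to identify different partial derivatives by unfolding them. *)
Ltac gen_at p := repeat match goal with |- context [?f p] => generalize (f p) end.

(** * Straight lines on the cone *)

Section Core.
Variables (R : realType) (K : nat).
Hypothesis K0 : (0 < K)%N.
Local Notation J := (jet R 3 2 K).
Local Notation idx := (jet_index 3 2 K).
Local Notation dir := (@jet_dir R 3 2 K).
Local Notation fld := (@jet_field R 3 2 K (@sys R)).
Local Notation T := (vfield dir fld).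
Local Notation L := (lie dir fld).
Local Notation X0 := (inl 0 : idx).
Local Notation X1 := (inl 1 : idx).
Local Notation X2 := (inl ord_max : idx).
Local Notation U0 := (inr (ord0, ord0) : idx).
Local Notation U1 := (inr (ord0, ord_max) : idx).
Local Notation u0 := (@jet_coord R 3 2 K U0).
Local Notation s := (@slope R K).

Variable W : set J.
Hypotheses (oW : open W) (W0 : forall p, W p -> u0 p != 0).

Lemma derivation_grad k : derivation W (fun h => grad dir h k).
Proof. exact: derivation_derive. Qed.

Lemma has_der_grad k h : smooth W h -> has_der W (fun h => grad dir h k) h (grad dir h k).
Proof. by []. Qed.

Lemma order0_grad k h : smooth W h -> order0 W (grad dir h) ->
  order0 W (grad dir (grad dir h k)).
Proof.
move=> sh oh l j p l0 Wp; rewrite /grad (derive_swap_on oW _ _ sh Wp).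
by apply: (derive_cst_on oW (c := 0)) => // q Wq; exact: oh.
Qed.

Lemma grad_swap k k' h p : smooth W h -> W p ->
  grad dir (grad dir h k) k' p = grad dir (grad dir h k') k p.
Proof. by move=> sh Wp; exact: (derive_swap_on oW). Qed.

Let v1E : (inord 1 : 'I_K.+1) = 1%N :> nat. Proof. by rewrite inordK. Qed.

(** T h is affine in u', and the coefficients are the derivatives of h with
    respect to u. *)
Lemma grad_vfield_du j h p : smooth W h -> order0 W (grad dir h) -> W p ->
  grad dir (T h) (inr (inord 1, j)) p = grad dir h (inr (ord0, j)) p.
Proof.
move=> sh oh Wp.
rewrite -(lie_grad oW dir (smooth_field oW W0) (inr (inord 1, j)) sh Wp).
rewrite (@lie_input_succ _ _ _ _ _ ord0 (inord 1)) ?v1E //.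
rewrite (@vfield_cst _ _ _ oW _ _ _ _ 0) ?add0r // => q Wq.
by apply: oh => //; rewrite v1E.
Qed.

Lemma grad_vfield_U0 h p : smooth W h -> W p ->
  grad dir (T h) U0 p = T (grad dir h U0) p +
    (grad dir h X0 p - s p * s p * 2^-1 * grad dir h X2 p).
Proof.
move=> sh Wp; rewrite -(lie_grad oW dir (smooth_field oW W0) U0 sh Wp).
rewrite (lieE oW W0 _ Wp) /=; last by case=> [[|l] lK] j.
by congr (_ + _); gen_at p; move=> *; field.
Qed.

Lemma grad_vfield_U1 h p : smooth W h -> W p ->
  grad dir (T h) U1 p = T (grad dir h U1) p +
    (grad dir h X1 p + s p * grad dir h X2 p).
Proof.
move=> sh Wp; rewrite -(lie_grad oW dir (smooth_field oW W0) U1 sh Wp).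
rewrite (lieE oW W0 _ Wp) /=; last by case=> [[|l] lK] j.
by congr (_ + _); gen_at p; move=> *; field.
Qed.

Lemma slope_der k : has_der W (fun h => grad dir h k) s
  (fun p => ((k == U1)%:R - s p * (k == U0)%:R) / u0 p).
Proof.
by split => [|p Wp]; [exact: smooth_slope|exact: (derive_slope oW W0 k Wp)].
Qed.

(** The data of the rank-one case: [phi] is phi_1, [om] and [ze] are omega and
    zeta, and E is [P0] d/du_2 - [P1] d/du_1. *)
Variables (phi c1 : J -> R) (om ze : idx -> J -> R).
Hypotheses (sphi : smooth W phi) (sc1 : smooth W c1)
  (som : forall k, smooth W (om k)) (sze : forall k, smooth W (ze k)).
Hypotheses (ophi : order0 W (grad dir phi)) (oc1 : order0 W (grad dir c1))
  (oom : forall i, order0 W (grad dir (om (inl i)))).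
Local Notation P0 := (grad dir phi U0).
Local Notation P1 := (grad dir phi U1).
Hypothesis P_neq0 : forall p, W p -> (P0 p != 0) || (P1 p != 0).
Hypothesis om_ker : forall i p, W p ->
  P0 p * grad dir (om (inl i)) U1 p - P1 p * grad dir (om (inl i)) U0 p = 0.
Hypothesis om_orth : forall p, W p -> P0 p * (om X1 p + s p * om X2 p) -
  P1 p * (om X0 p - s p * s p * 2^-1 * om X2 p) = 0.
Hypothesis ze_orth : forall p, W p -> P0 p * (ze X1 p + s p * ze X2 p) -
  P1 p * (ze X0 p - s p * s p * 2^-1 * ze X2 p) = 0.
Hypotheses
  (c1E0 : forall p, W p -> om X0 p - s p * s p * 2^-1 * om X2 p = c1 p * P0 p)
  (c1E1 : forall p, W p -> om X1 p + s p * om X2 p = c1 p * P1 p).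
Hypotheses
  (ze0E : forall p, W p -> ze X0 p = T (om X0) p + om X2 p - c1 p * grad dir phi X0 p)
  (ze1E : forall p, W p -> ze X1 p = T (om X1) p - c1 p * grad dir phi X1 p)
  (ze2E : forall p, W p -> ze X2 p = T (om X2) p - c1 p * grad dir phi X2 p).
Hypothesis cross_neq0 : forall p, W p ->
  ~ [/\ om X0 p * ze X1 p - om X1 p * ze X0 p = 0,
        om X0 p * ze X2 p - om X2 p * ze X0 p = 0 &
        om X1 p * ze X2 p - om X2 p * ze X1 p = 0].

Let sP k : smooth W (grad dir phi k). Proof. exact: smooth_grad. Qed.
Let sTom k : smooth W (T (om k)).
Proof. by apply: smooth_vfield => // i; exact: smooth_field. Qed.

Let sum_der O : derivation W O -> forall f g, smooth W f -> smooth W g ->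
  has_der W O (fun p => f p + g p) (fun p => O f p + O g p).
Proof. by move=> dO f g sf sg; apply: (has_derD oW dO). Qed.

(** Only zeta = L omega - c_1 d phi_1 involves u', and its derivative with
    respect to u'_j is the derivative of omega with respect to u_j; so the
    derivative of zeta(Ef) = 0 along u' is an orthogonality relation for the
    derivatives of omega in u. *)
Let om_grad_orth j p : W p ->
  P0 p * (grad dir (om X1) (inr (ord0, j)) p +
          s p * grad dir (om X2) (inr (ord0, j)) p) -
  P1 p * (grad dir (om X0) (inr (ord0, j)) p -
          s p * s p * 2^-1 * grad dir (om X2) (inr (ord0, j)) p) = 0.
Proof.
move=> Wp; pose v : idx := inr (inord 1, j).
pose Dv h := grad dir h v; have dO : derivation W Dv := derivation_grad v.
have l0 : (0 < (inord 1 : 'I_K.+1))%N by rewrite v1E.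
have Os : has_der W Dv s (fun=> 0).
  split=> [|q Wq]; first exact: smooth_slope.
  rewrite /Dv (slope_der v).2 //.
  have -> : (v == U1) = false by apply/eqP => -[/(congr1 val)]; rewrite /= v1E.
  have -> : (v == U0) = false by apply/eqP => -[/(congr1 val)]; rewrite /= v1E.
  by rewrite mulr0 subr0 mul0r.
have OP k : has_der W Dv (grad dir phi k) (fun=> 0).
  by split=> // q Wq; exact: (order0_grad k sphi ophi).
have Oc1 : has_der W Dv c1 (fun=> 0) by split=> // q Wq; exact: oc1.
have OT i : has_der W Dv (T (om (inl i))) (grad dir (om (inl i)) (inr (ord0, j))).
  by split=> // q Wq; exact: grad_vfield_du.
have Oz k f f' : (forall q, W q -> ze k q = f q - c1 q * grad dir phi k q) ->
    has_der W Dv f f' -> has_der W Dv (ze k) f'.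
  move=> zE Of; split=> // q Wq.
  rewrite (der_sub_mul oW dO (has_der_atom _ (sze k)) Of Oc1 (OP k) zE Wq).
  by rewrite mul0r mulr0 addr0 subr0.
have Oz0 : has_der W Dv (ze X0) (grad dir (om X0) (inr (ord0, j))).
  apply: (Oz X0 _ _ ze0E); split=> [|q Wq]; first by apply: smoothD.
  rewrite (sum_der dO (sTom X0) (som X2)).2 // (OT 0).2 //.
  have -> : Dv (om X2) q = 0 by exact: oom.
  by rewrite addr0.
have Oz1 := Oz X1 _ _ ze1E (OT 1); have Oz2 := Oz X2 _ _ ze2E (OT ord_max).
have := der_orth oW dO Os (OP U0) (OP U1) Oz0 Oz1 Oz2 ze_orth Wp.
by rewrite !mul0r subr0 !add0r mulr0 mul0r addr0.
Qed.

Let iu p := (u0 p)^-1.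

Let Us0 : has_der W (fun h => grad dir h U0) s (fun p => - s p * iu p).
Proof. by split=> [|p Wp]; [exact: smooth_slope|rewrite (slope_der U0).2 // eqxx mulr1 sub0r]. Qed.

Let Us1 : has_der W (fun h => grad dir h U1) s iu.
Proof. by split=> [|p Wp]; [exact: smooth_slope|rewrite (slope_der U1).2 // eqxx mulr0 subr0 mul1r]. Qed.

Let Xs i : has_der W (fun h => grad dir h (inl i)) s (fun=> 0).
Proof. by split=> [|p Wp]; [exact: smooth_slope|rewrite (slope_der (inl i)).2 // mulr0 subr0 mul0r]. Qed.

Let at_ k h (sh : smooth W h) := has_der_grad k sh.

Let orth_U0 p : W p ->
  grad dir P0 U0 p * (c1 p * P1 p) - grad dir P0 U1 p * (c1 p * P0 p) +
  om X2 p * (- s p * iu p) * (P0 p + s p * P1 p) = 0.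
Proof.
move=> Wp; have := der_orth oW (derivation_grad U0) Us0 (at_ U0 (sP U0))
  (at_ U0 (sP U1)) (at_ U0 (som X0)) (at_ U0 (som X1)) (at_ U0 (som X2)) om_orth Wp.
move=> H; exact: (orth_in_frame H (om_grad_orth ord0 Wp) (c1E0 Wp) (c1E1 Wp)
  (grad_swap U1 U0 sphi Wp)).
Qed.

Let orth_U1 p : W p ->
  grad dir P0 U1 p * (c1 p * P1 p) - grad dir P1 U1 p * (c1 p * P0 p) +
  om X2 p * iu p * (P0 p + s p * P1 p) = 0.
Proof.
move=> Wp; have := der_orth oW (derivation_grad U1) Us1 (at_ U1 (sP U0))
  (at_ U1 (sP U1)) (at_ U1 (som X0)) (at_ U1 (som X1)) (at_ U1 (som X2)) om_orth Wp.
move=> H; exact: (orth_in_frame H (om_grad_orth ord_max Wp) (c1E0 Wp) (c1E1 Wp) erefl).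
Qed.

Let orth_X i p : W p ->
  c1 p * (grad dir P0 (inl i) p * P1 p - grad dir P1 (inl i) p * P0 p) +
  (P0 p * (grad dir (om X1) (inl i) p + s p * grad dir (om X2) (inl i) p) -
   P1 p * (grad dir (om X0) (inl i) p - s p * s p * 2^-1 * grad dir (om X2) (inl i) p))
  = 0.
Proof.
move=> Wp; have := der_orth oW (derivation_grad (inl i)) (Xs i) (at_ (inl i) (sP U0))
  (at_ (inl i) (sP U1)) (at_ (inl i) (som X0)) (at_ (inl i) (som X1))
  (at_ (inl i) (som X2)) om_orth Wp.
rewrite mulr0 mul0r addr0 c1E0 // c1E1 // => <-.
by gen_at p; move=> *; ring.
Qed.

Let c1_ker p : W p -> P0 p * grad dir c1 U1 p - P1 p * grad dir c1 U0 p = 0.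
Proof.
move=> Wp.
have x0 := der_orth_x oW (derivation_grad U0) Us0 (at_ U0 (sP U0)) (at_ U0 (som X0))
  (at_ U0 (som X2)) (at_ U0 sc1) c1E0 Wp.
have x1 := der_orth_x oW (derivation_grad U1) Us1 (at_ U1 (sP U0)) (at_ U1 (som X0))
  (at_ U1 (som X2)) (at_ U1 sc1) c1E0 Wp.
have y0 := der_orth_y oW (derivation_grad U0) Us0 (at_ U0 (sP U1)) (at_ U0 (som X1))
  (at_ U0 (som X2)) (at_ U0 sc1) c1E1 Wp.
have y1 := der_orth_y oW (derivation_grad U1) Us1 (at_ U1 (sP U1)) (at_ U1 (som X1))
  (at_ U1 (som X2)) (at_ U1 sc1) c1E1 Wp.
exact: (orth_coef_ker (om_ker 0 Wp) (om_ker 1 Wp) (om_ker ord_max Wp)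
  (orth_U0 Wp) (orth_U1 Wp) x0 x1 y0 y1 (grad_swap U1 U0 sphi Wp) (P_neq0 Wp)).
Qed.

(** E(zeta_i) computed from the bracket of E with T; [t] collects the terms of
    L omega other than T omega_i, and E annihilates it. *)
Let ze_fibre i t p : smooth W t ->
  (forall q, W q -> P0 q * grad dir t U1 q - P1 q * grad dir t U0 q = 0) ->
  (forall q, W q -> ze (inl i) q =
     T (om (inl i)) q + t q - c1 q * grad dir phi (inl i) q) -> W p ->
  P0 p * grad dir (ze (inl i)) U1 p - P1 p * grad dir (ze (inl i)) U0 p =
  P0 p * (grad dir (om (inl i)) X1 p + s p * grad dir (om (inl i)) X2 p) -
  P1 p * (grad dir (om (inl i)) X0 p -
          s p * s p * 2^-1 * grad dir (om (inl i)) X2 p) -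
  (T P0 p * grad dir (om (inl i)) U1 p - T P1 p * grad dir (om (inl i)) U0 p) -
  c1 p * (P0 p * grad dir P1 (inl i) p - P1 p * grad dir P0 (inl i) p).
Proof.
move=> st tker zE Wp; have dTv := derivation_vfield oW dir fld.
have dk k := der_sub_mul oW (derivation_grad k) (at_ k (sze (inl i)))
  (sum_der (derivation_grad k) (sTom (inl i)) st) (at_ k sc1)
  (at_ k (sP (inl i))) zE Wp.
have E0 := dk U0; have E1 := dk U1.
rewrite grad_vfield_U0 // (grad_swap (inl i) U0 sphi Wp) in E0.
rewrite grad_vfield_U1 // (grad_swap (inl i) U1 sphi Wp) in E1.
have sg k : smooth W (grad dir (om (inl i)) k) by exact: smooth_grad.
have EK := der_ker oW dTv (has_der_atom T (sP U0)) (has_der_atom T (sP U1))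
  (has_der_atom T (sg U0)) (has_der_atom T (sg U1)) (om_ker i) Wp.
have Ec := c1_ker Wp; have Et := tker p Wp.
rewrite E0 E1; apply/eqP; rewrite -subr_eq0; apply/eqP.
move: Ec Et EK; set c := (X in X = 0 -> _) => Ec; set tt := (X in X = 0 -> _) => Et.
set k := (X in X = 0 -> _) => EK.
transitivity (tt + k - grad dir phi (inl i) p * c); last by rewrite Ec Et EK mulr0 !addr0 subr0.
by rewrite /c /tt /k; gen_at p; move=> *; field.
Qed.

Let ze_ker p : W p ->
  P0 p * ((P0 p * grad dir (ze X1) U1 p - P1 p * grad dir (ze X1) U0 p) +
    s p * (P0 p * grad dir (ze X2) U1 p - P1 p * grad dir (ze X2) U0 p)) -
  P1 p * ((P0 p * grad dir (ze X0) U1 p - P1 p * grad dir (ze X0) U0 p) -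
    s p * s p * 2^-1 *
      (P0 p * grad dir (ze X2) U1 p - P1 p * grad dir (ze X2) U0 p)) = 0.
Proof.
move=> Wp; have s0 : smooth W (fun=> 0) by exact: smooth_cst.
have k0 q : W q -> P0 q * grad dir (fun=> 0) U1 q - P1 q * grad dir (fun=> 0) U0 q = 0.
  move=> Wq; rewrite (der_cst (derivation_grad U0)) // (der_cst (derivation_grad U1)) //.
  by rewrite !mulr0 subr0.
have z1' q : W q -> ze X1 q = T (om X1) q + 0 - c1 q * grad dir phi X1 q.
  by move=> Wq; rewrite ze1E // addr0.
have z2' q : W q -> ze X2 q = T (om X2) q + 0 - c1 q * grad dir phi X2 q.
  by move=> Wq; rewrite ze2E // addr0.
exact: (orth_zeta_ker (orth_X 0 Wp) (orth_X 1 Wp) (orth_X ord_max Wp)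
  (om_grad_orth ord0 Wp) (om_grad_orth ord_max Wp)
  (ze_fibre (som X2) (om_ker ord_max) ze0E Wp)
  (ze_fibre s0 k0 z1' Wp) (ze_fibre s0 k0 z2' Wp)).
Qed.

Let iu0 p : W p -> iu p != 0. Proof. by move=> Wp; rewrite invr_neq0 ?W0. Qed.

(** E points along the ruling. *)
Let ruling p : W p -> P0 p + s p * P1 p = 0.
Proof.
move=> Wp.
have z0 := der_orth oW (derivation_grad U0) Us0 (at_ U0 (sP U0)) (at_ U0 (sP U1))
  (at_ U0 (sze X0)) (at_ U0 (sze X1)) (at_ U0 (sze X2)) ze_orth Wp.
have z1 := der_orth oW (derivation_grad U1) Us1 (at_ U1 (sP U0)) (at_ U1 (sP U1))
  (at_ U1 (sze X0)) (at_ U1 (sze X1)) (at_ U1 (sze X2)) ze_orth Wp.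
rewrite (grad_swap U1 U0 sphi Wp) in z0.
exact: (straight_line_is_ruling (om_orth Wp) (ze_orth Wp) (c1E0 Wp) (c1E1 Wp) (orth_U0 Wp)
  (orth_U1 Wp) z0 z1 (ze_ker Wp) (cross_neq0 Wp) (P_neq0 Wp) (iu0 Wp)).
Qed.

Let P1_neq0 p : W p -> P1 p != 0.
Proof.
move=> Wp; apply/eqP => P10; have := P_neq0 Wp; have := ruling Wp.
by rewrite P10 mulr0 addr0 => ->; rewrite eqxx.
Qed.

Let c1_eq0 p : W p -> c1 p = 0.
Proof.
move=> Wp; have dU := derivation_grad U1.
have := has_der_zero dU (has_derD oW dU (at_ U1 (sP U0))
  (has_derM oW dU Us1 (at_ U1 (sP U1)))) ruling Wp.
have := orth_U1 Wp; rewrite (ruling Wp) mulr0 addr0.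
have : P0 p = - (s p * P1 p) by apply/eqP; rewrite -addr_eq0 ruling.
move=> -> E1 E2; have : c1 p * iu p * P1 p * P1 p = 0.
  move: E1 E2; set e1 := (X in X = 0 -> _) => E1; set e2 := (X in X = 0 -> _) => E2.
  transitivity (c1 p * P1 p * e2 - e1); last by rewrite E1 E2 mulr0 subr0.
  by rewrite /e1 /e2; gen_at p; move=> *; ring.
move=> /eqP; rewrite !mulf_eq0 (negbTE (P1_neq0 Wp)) (negbTE (iu0 Wp)) !orbF.
by move/eqP.
Qed.

(** With E along the ruling, omega is a multiple of the conormal of the cone and
    c_1 = 0; then omega = 0. *)
Lemma straight_lines_absurd p : W p -> False.
Proof.
move=> Wp; have dTv := derivation_vfield oW dir fld.
have x0 q : W q -> om X0 q - s q * s q * 2^-1 * om X2 q = 0.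
  by move=> Wq; rewrite c1E0 // c1_eq0 // mul0r.
have y0 q : W q -> om X1 q + s q * om X2 q = 0.
  by move=> Wq; rewrite c1E1 // c1_eq0 // mul0r.
have sS : smooth W s by exact: smooth_slope.
have sz : smooth W (fun=> 0 : R) by exact: smooth_cst.
have c0 : has_der W T (fun=> 0) (fun=> 0) by exact: has_der_cst.
have xT := der_orth_x oW dTv (has_der_atom T sS) (has_der_atom T (sP U0))
  (has_der_atom T (som X0)) (has_der_atom T (som X2)) c0
  (fun q Wq => etrans (x0 q Wq) (esym (mul0r (P0 q)))) Wp.
have yT := der_orth_y oW dTv (has_der_atom T sS) (has_der_atom T (sP U1))
  (has_der_atom T (som X1)) (has_der_atom T (som X2)) c0
  (fun q Wq => etrans (y0 q Wq) (esym (mul0r (P1 q)))) Wp.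
have om2 : om X2 p = 0.
  exact: (ruling_conormal_eq0 (ze_orth Wp) (ze0E Wp) (ze1E Wp) (ze2E Wp) xT yT
            (ruling Wp) (c1_eq0 Wp) (P1_neq0 Wp)).
apply: (cross_neq0 Wp).
have := x0 p Wp; have := y0 p Wp; rewrite om2 !mulr0 addr0 subr0 => -> ->.
by rewrite !mul0r subr0.
Qed.

End Core.

(** * Exclusion of every pair of outputs *)

Section Obstruction.
Variables (R : realType) (K r : nat).
Hypotheses (K0 : (0 < K)%N) (rK : (r <= K)%N).
Local Notation J := (jet R 3 2 K).
Local Notation idx := (jet_index 3 2 K).
Local Notation dir := (@jet_dir R 3 2 K).
Local Notation fld := (@jet_field R 3 2 K (@sys R)).
Local Notation T := (vfield dir fld).
Local Notation L := (lie dir fld).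
Local Notation grad := (grad dir).
Local Notation annul := (annul dir fld).
Local Notation X0 := (inl 0 : idx).
Local Notation X1 := (inl 1 : idx).
Local Notation X2 := (inl ord_max : idx).
Local Notation U0 := (inr (ord0, ord0) : idx).
Local Notation U1 := (inr (ord0, ord_max) : idx).
Local Notation u0 := (@jet_coord R 3 2 K U0).
Local Notation s := (@slope R K).
Implicit Types (phi : J -> R) (eta zeta chi : idx -> J -> R) (p : J) (v : idx -> R).

Definition smooth_form (W : set J) eta := forall k, smooth W (eta k).

(** A form in dx only. *)
Definition dx_form (W : set J) eta :=
  forall l j p, W p -> eta (inr (l, j)) p = 0.

(** What is kept of flatness, in a form that passes to smaller open sets and
    is symmetric in the two outputs. *)
Record flat_pair (W : set J) (phi0 phi1 : J -> R) : Prop := FlatPair {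
  fp_open : open W;
  fp_dom : forall p, W p -> u0 p != 0;
  fp_smooth0 : smooth W phi0;
  fp_smooth1 : smooth W phi1;
  fp_order0 : order0 W (grad phi0);
  fp_order1 : order0 W (grad phi1);
  fp_flat : forall p v, W p -> annul r (grad phi0) v p -> annul r (grad phi1) v p ->
    (forall i, v (inl i) = 0) /\ (forall j, v (inr (ord0, j)) = 0) }.

Lemma flat_pairC W phi0 phi1 : flat_pair W phi0 phi1 -> flat_pair W phi1 phi0.
Proof. by case=> oW W0 s0 s1 o0 o1 H; split=> // p v Wp a0 a1; exact: H a1 a0. Qed.

Lemma flat_pair_sub W W' phi0 phi1 : open W' -> W' `<=` W ->
  flat_pair W phi0 phi1 -> flat_pair W' phi0 phi1.
Proof.
move=> oW' WW [oW W0 s0 s1 o0 o1 H]; split=> //.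
- by move=> p /WW; exact: W0.
- exact: smooth_sub s0.
- exact: smooth_sub s1.
- by move=> l j p l0 /WW; exact: o0.
- by move=> l j p l0 /WW; exact: o1.
- by move=> p v /WW; exact: H.
Qed.

(** The counting argument: the four forms leave a nonzero direction in the
    (x,u)-space, which extends to a tangent vector that flatness forbids. *)
Lemma too_few_forms W phi0 phi1 zeta1 zeta2 chi1 chi2 p :
  flat_pair W phi0 phi1 -> W p ->
  order0 W zeta1 -> order0 W zeta2 -> order0 W chi1 -> order0 W chi2 ->
  symbol_det zeta1 zeta2 p != 0 ->
  (forall v, pairing chi1 v p = 0 -> pairing chi2 v p = 0 ->
     annul r zeta1 v p -> annul r zeta2 v p ->
     annul r (grad phi0) v p /\ annul r (grad phi1) v p) -> False.
Proof.
move=> [oW W0 s0 s1 o0 o1 H] Wp oz1 oz2 oc1 oc2 D Hv.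
pose chi (c : 'I_4) := nth zeta1 [:: zeta1; zeta2; chi1; chi2] c.
have ochi c : order0 W (chi c).
  by case: c => -[|[|[|[|]]]].
have [v0 [nz v0z]] := four_forms_common_zero Wp ochi.
have z1 : pairing zeta1 v0 p = 0 by exact: (v0z 0).
have z2 : pairing zeta2 v0 p = 0 by exact: (v0z 1).
have c1 : pairing chi1 v0 p = 0 by exact: (v0z (@Ordinal 4 2 isT)).
have c2 : pairing chi2 v0 p = 0 by exact: (v0z (@Ordinal 4 3 isT)).
have [v [vx vu a1 a2]] := annul_extend oW (@sys R) oz1 oz2 Wp D z1 z2 rK.
have pv chi' : order0 W chi' -> pairing chi' v p = pairing chi' v0 p.
  move=> oc; apply: eq_bigr => -[i|[l j]] _; first by rewrite vx.
  have [->|l0] := eqVneq l ord0; first by rewrite vu.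
  by rewrite oc ?mulr0 // lt0n.
have [b0 b1] : annul r (grad phi0) v p /\ annul r (grad phi1) v p.
  by apply: Hv => //; rewrite pv.
have [hx hu] := H _ _ Wp b0 b1.
by apply: nz; split=> [i|j]; [rewrite -vx|rewrite -vu].
Qed.

(** The constant form [a] du_1 + [b] du_2. *)
Definition const_form (a b : R) (k : idx) (p : J) : R :=
  a * (k == U0)%:R + b * (k == U1)%:R.

Lemma order0_const W a b : order0 W (const_form a b).
Proof.
move=> l j p l0 _; rewrite /const_form.
have -> : (inr (l, j) == U0) = false by apply/eqP => -[] l1 _; rewrite l1 in l0.
have -> : (inr (l, j) == U1) = false by apply/eqP => -[] l1 _; rewrite l1 in l0.
by rewrite !mulr0 addr0.
Qed.

Lemma const_form_U0 a b p : const_form a b U0 p = a.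
Proof.
rewrite /const_form; have -> : (U0 == U1) = false by apply/eqP => -[].
by rewrite eqxx mulr1 mulr0 addr0.
Qed.

Lemma const_form_U1 a b p : const_form a b U1 p = b.
Proof.
rewrite /const_form; have -> : (U1 == U0) = false by apply/eqP => -[].
by rewrite eqxx mulr1 mulr0 add0r.
Qed.

(** Any form with nonzero du-part is completed by a constant form to a pair with
    independent du-parts. *)
Lemma symbol_det_const eta p :
  symbol_det eta (const_form (- eta U1 p) (eta U0 p)) p =
  eta U0 p * eta U0 p + eta U1 p * eta U1 p.
Proof. by rewrite /symbol_det const_form_U0 const_form_U1 mulrN opprK. Qed.

Lemma sqr_sum_neq0 (a b : R) : (a != 0) || (b != 0) -> a * a + b * b != 0.
Proof.
move=> ab; apply/eqP => H; move: ab; rewrite -negb_and => /negP; apply.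
have := sqr_ge0 a; have := sqr_ge0 b; rewrite !expr2 => b0 a0.
have : a * a = 0 /\ b * b = 0 by split; lra.
by move=> [/eqP + /eqP]; rewrite !mulf_eq0 !orbb => -> ->.
Qed.

Lemma annul_zero_form W eta v p b : open W -> W p -> (forall k q, W q -> eta k q = 0) ->
  annul b eta v p.
Proof.
move=> oW Wp e0; suff H i k q : W q -> iter i L eta k q = 0.
  by move=> i _; apply: big1 => k _; rewrite H ?mulr0.
elim: i k q => [|i IH] k q Wq; first exact: e0.
rewrite /= /lie (@vfield_cst _ _ _ oW _ _ _ _ 0) //; last by move=> y; exact: IH.
by rewrite add0r big1 // => j _; rewrite IH ?mulr0.
Qed.

Lemma annul_sub W eta theta c b v p : open W -> (forall q, W q -> u0 q != 0) ->
  W p -> smooth W c -> smooth_form W eta -> smooth_form W theta ->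
  annul b (fun k q => eta k q - c q * theta k q) v p ->
  annul b theta v p -> annul b eta v p.
Proof.
move=> oW W0 Wp sc se st a1 a2.
have sF k : smooth W (fld k) by exact: smooth_field.
have sct k : smooth W (fun q => c q * theta k q) by exact: smoothM.
have H : annul b (fun k q => (eta k q - c q * theta k q) + c q * theta k q) v p.
  apply: (annulD oW sF) => //; first by move=> k; exact: smoothB.
  exact: (annulZ oW sF).
by apply: (annul_ext oW Wp _ H) => k q _; rewrite subrK.
Qed.

Lemma annul_lie b eta v p : pairing eta v p = 0 -> annul b (L eta) v p ->
  annul b eta v p.
Proof.
move=> e0 a; apply: (annul_le (leqnSn b)); exact/annulS.
Qed.

Section DxForms.
Variable W : set J.
Hypotheses (oW : open W) (W0 : forall p, W p -> u0 p != 0).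

Lemma dx_order0 eta : dx_form W eta -> order0 W eta.
Proof. by move=> de l j p _; exact: de. Qed.

Lemma order0_lie eta : dx_form W eta -> order0 W (L eta).
Proof.
move=> de l j p l0 Wp.
have lK : (l.-1 < K.+1)%N by exact: leq_ltn_trans (leq_pred l) _.
rewrite (@lie_input_succ _ _ _ _ _ (Ordinal lK) l) /= ?prednK //.
rewrite (@vfield_cst _ _ _ oW _ _ _ _ 0) //; last by move=> q; exact: de.
by rewrite add0r de.
Qed.

Lemma lie_U0 eta p : dx_form W eta -> W p ->
  L eta U0 p = eta X0 p - s p * s p * 2^-1 * eta X2 p.
Proof.
move=> de Wp; rewrite (lieE oW W0 _ Wp) /=; last by case=> [[|l] lK] j.
rewrite (@vfield_cst _ _ _ oW _ _ _ _ 0) //; last by move=> q; exact: de.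
by rewrite add0r mul1r mul0r addr0 mulr0 addr0 add0r mulr1 expr2 mulNr.
Qed.

Lemma lie_U1 eta p : dx_form W eta -> W p -> L eta U1 p = eta X1 p + s p * eta X2 p.
Proof.
move=> de Wp; rewrite (lieE oW W0 _ Wp) /=; last by case=> [[|l] lK] j.
rewrite (@vfield_cst _ _ _ oW _ _ _ _ 0) //; last by move=> q; exact: de.
by rewrite add0r mul1r mul0r add0r !mulr0 mulr1 subr0 add0r.
Qed.

Lemma lie_X0 eta p : W p -> L eta X0 p = T (eta X0) p + eta X2 p.
Proof.
move=> Wp; rewrite (lieE oW W0 _ Wp) //=.
by rewrite !mul0r !mulr0 addr0 subr0 addr0 add0r mul1r.
Qed.

Lemma lie_X1 eta p : W p -> L eta X1 p = T (eta X1) p.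
Proof.
move=> Wp; rewrite (lieE oW W0 _ Wp) //=.
by rewrite !mul0r !mulr0 addr0 subr0 !add0r mul0r addr0.
Qed.

Lemma lie_X2 eta p : W p -> L eta X2 p = T (eta X2) p.
Proof.
move=> Wp; rewrite (lieE oW W0 _ Wp) //=.
by rewrite !mul0r !mulr0 addr0 subr0 !add0r mul0r addr0.
Qed.

End DxForms.

Lemma dx_grad W phi : order0 W (grad phi) ->
  (forall p, W p -> grad phi U0 p = 0) -> (forall p, W p -> grad phi U1 p = 0) ->
  dx_form W (grad phi).
Proof.
move=> o e0 e1 l j p Wp; have [->|l0] := eqVneq l ord0; last by rewrite o ?lt0n.
case: j => -[|[|//]] lj.
  by rewrite (_ : Ordinal lj = ord0) ?e0 //; exact: val_inj.
by rewrite (_ : Ordinal lj = ord_max) ?e1 //; exact: val_inj.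
Qed.

(** Otherwise d phi_1 and d phi_2 generate everything with no further form. *)
Lemma input_jacobian_det W phi0 phi1 p : flat_pair W phi0 phi1 -> W p ->
  grad phi0 U0 p * grad phi1 U1 p - grad phi0 U1 p * grad phi1 U0 p = 0.
Proof.
move=> fp Wp; apply/eqP; apply/negP => /negP D.
have [oW W0 _ _ o0 o1 _] := fp.
by apply: (too_few_forms fp Wp o0 o1 o0 o0 D).
Qed.

(** The du-parts of L (d phi_j) are the derivatives of T phi_j with respect to
    u; were they independent, the four forms d phi_j and L (d phi_j) would
    generate everything. *)
Lemma input_free_det W phi0 phi1 p : flat_pair W phi0 phi1 -> W p ->
  dx_form W (grad phi0) -> dx_form W (grad phi1) ->
  (grad phi0 X0 p - s p * s p * 2^-1 * grad phi0 X2 p) *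
    (grad phi1 X1 p + s p * grad phi1 X2 p) -
  (grad phi0 X1 p + s p * grad phi0 X2 p) *
    (grad phi1 X0 p - s p * s p * 2^-1 * grad phi1 X2 p) = 0.
Proof.
move=> fp Wp d0 d1; apply/eqP; apply/negP => /negP D.
have [oW W0 _ _ _ _ _] := fp.
apply: (too_few_forms fp Wp (order0_lie oW d0) (order0_lie oW d1) (dx_order0 d0)
  (dx_order0 d1)).
  by rewrite /symbol_det !(lie_U0 oW W0) // !(lie_U1 oW W0).
by move=> v p0 p1 a0 a1; split; exact: annul_lie.
Qed.

Lemma grad_dx_form W phi k p : open W -> smooth W phi -> dx_form W (grad phi) ->
  W p -> forall l j, grad (grad phi k) (inr (l, j)) p = 0.
Proof.
move=> oW sp dp Wp l j; rewrite (grad_swap oW _ _ sp Wp).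
by apply: (derive_cst_on oW (c := 0)) => // q Wq; exact: dp.
Qed.

Lemma input_free_der W phi i : open W -> smooth W phi -> dx_form W (grad phi) ->
  has_der W (fun h => grad h U1) (grad phi (inl i)) (fun=> 0).
Proof.
move=> oW sp dp; split=> [|p Wp]; first exact: smooth_grad.
by rewrite (grad_dx_form _ oW sp dp Wp).
Qed.

Lemma slope_der_U1 W : open W -> (forall p, W p -> u0 p != 0) ->
  has_der W (fun h => grad h U1) s (fun p => (u0 p)^-1).
Proof.
move=> oW W0; have [ss sd] := slope_der oW W0 U1; split=> // p Wp.
by rewrite sd // eqxx mulr0 subr0 mul1r.
Qed.

Lemma smooth_grad_form W phi : smooth W phi -> smooth_form W (grad phi).
Proof. by move=> sp k; exact: smooth_grad. Qed.

(** If d phi_2 is a multiple of d phi_1, a single form [zeta], a constant form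
    that completes it, and [chi] suffice. *)
Lemma proportional_absurd W phi0 phi1 c p : flat_pair W phi0 phi1 -> W p ->
  smooth W c -> (forall k q, W q -> grad phi1 k q - c q * grad phi0 k q = 0) ->
  forall zeta chi, order0 W zeta -> order0 W chi ->
  (zeta U0 p != 0) || (zeta U1 p != 0) ->
  (forall v, pairing chi v p = 0 -> annul r zeta v p -> annul r (grad phi0) v p) ->
  False.
Proof.
move=> fp Wp sc cE zeta chi oz oc z0 H; have [oW W0 s0 s1 _ _ _] := fp.
apply: (too_few_forms fp Wp oz (@order0_const W (- zeta U1 p) (zeta U0 p)) oc oc).
  by rewrite symbol_det_const sqr_sum_neq0.
move=> v p0 _ az _; have a0 := H v p0 az; split=> //.
apply: (annul_sub oW W0 Wp sc) a0; [exact: smooth_grad_form|exact: smooth_grad_form|].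
exact: annul_zero_form oW Wp cE.
Qed.

(** The vanishing of the determinant along the whole cone makes the two
    gradients proportional. *)
Lemma input_free_noncritical_absurd W phi0 phi1 p : flat_pair W phi0 phi1 -> W p ->
  dx_form W (grad phi0) -> dx_form W (grad phi1) ->
  grad phi0 X0 p * grad phi0 X0 p + grad phi0 X1 p * grad phi0 X1 p +
    grad phi0 X2 p * grad phi0 X2 p != 0 -> False.
Proof.
pose n q := grad phi0 X0 q * grad phi0 X0 q + grad phi0 X1 q * grad phi0 X1 q +
    grad phi0 X2 q * grad phi0 X2 q.
move=> fp Wp d0 d1 np; have [oW W0 s0 s1 _ _ _] := fp.
have sg0 := smooth_grad_form s0; have sg1 := smooth_grad_form s1.
have sn : smooth W n by exact: smooth_dot3.
pose W' := W `&` [set q | n q != 0].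
have oW' : open W' by exact: open_neq0.
have WW : W' `<=` W by move=> q [].
have fp' := flat_pair_sub oW' WW fp; have [_ W0' s0' s1' _ _ _] := fp'.
have sg0' := smooth_grad_form s0'; have sg1' := smooth_grad_form s1'.
have d0' : dx_form W' (grad phi0) by move=> l j q /WW; exact: d0.
have d1' : dx_form W' (grad phi1) by move=> l j q /WW; exact: d1.
have minors q : W q -> _ := cone_minors oW (derivation_grad oW U1)
  (slope_der_U1 oW W0) (fun p Wp => invr_neq0 (W0 p Wp))
  (input_free_der 0 oW s0 d0) (input_free_der 1 oW s0 d0)
  (input_free_der ord_max oW s0 d0)
  (input_free_der 0 oW s1 d1) (input_free_der 1 oW s1 d1)
  (input_free_der ord_max oW s1 d1)
  (fun q Wq => input_free_det fp Wq d0 d1) (x := q).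
pose c q := (grad phi0 X0 q * grad phi1 X0 q + grad phi0 X1 q * grad phi1 X1 q +
  grad phi0 X2 q * grad phi1 X2 q) * (n q)^-1.
have sc : smooth W' c.
  apply: smoothM => //; first exact: smooth_dot3.
  by apply: smoothV => // [q []//|]; exact: smooth_sub sn.
have cE k q : W' q -> grad phi1 k q - c q * grad phi0 k q = 0.
  move=> W'q; have [Wq nq] := W'q; have [m01 m02 m12] := minors q Wq.
  case: k => [i|[l j]]; last by rewrite d0' // d1' // mulr0 subr0.
  have [c0 c1 c2] := parallel3 m01 m02 m12 nq.
  by case: (ord3_case i) => ->; [exact: c0|exact: c1|exact: c2].
have [q [W'q nz]] : exists q, W' q /\ ((L (grad phi0) U0 q != 0) || (L (grad phi0) U1 q != 0)).
  apply/not_existsP => H.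
  have z q : W' q -> L (grad phi0) U0 q = 0 /\ L (grad phi0) U1 q = 0.
    by move=> W'q; apply: nor_neq0 => nz; apply: (H q).
  have h0 q : W' q -> grad phi0 X0 q - s q * s q * 2^-1 * grad phi0 X2 q = 0.
    by move=> W'q; exact: etrans (esym (lie_U0 oW' W0' d0' W'q)) (proj1 (z q W'q)).
  have h1 q : W' q -> grad phi0 X1 q + s q * grad phi0 X2 q = 0.
    by move=> W'q; exact: etrans (esym (lie_U1 oW' W0' d0' W'q)) (proj2 (z q W'q)).
  have [e0 e1 e2] := cone_conormal oW' (derivation_grad oW' U1)
    (slope_der_U1 oW' W0') (fun p Wp => invr_neq0 (W0' p Wp))
    (input_free_der 1 oW' s0' d0') (input_free_der ord_max oW' s0' d0')
    h0 h1 (conj Wp np : W' p).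
  by move: np; rewrite e0 e1 e2 !mulr0 !addr0 eqxx.
apply: (proportional_absurd fp' W'q sc cE (order0_lie oW' d0') (dx_order0 d0') nz).
by move=> v; exact: annul_lie.
Qed.

Lemma input_free_absurd W phi0 phi1 p : flat_pair W phi0 phi1 -> W p ->
  dx_form W (grad phi0) -> dx_form W (grad phi1) -> False.
Proof.
move=> fp Wp d0 d1; have [oW W0 s0 s1 _ _ _] := fp.
have z phi0' phi1' : flat_pair W phi0' phi1' -> dx_form W (grad phi0') ->
    dx_form W (grad phi1') -> forall k q, W q -> grad phi0' k q = 0.
  move=> fp' d0' d1' k q Wq; case: k => [i|[l j]]; last exact: d0'.
  have [n0|n0] := eqVneq (grad phi0' X0 q * grad phi0' X0 q +
    grad phi0' X1 q * grad phi0' X1 q + grad phi0' X2 q * grad phi0' X2 q) 0.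
    have [e0 e1 e2] := sqr_sum3_eq0 n0.
    by case: (ord3_case i) => ->; [exact: e0|exact: e1|exact: e2].
  by case: (input_free_noncritical_absurd fp' Wq d0' d1').
apply: (too_few_forms fp Wp (@order0_const W 1 0) (@order0_const W 0 1)
  (dx_order0 d0) (dx_order0 d0)).
  by rewrite /symbol_det !const_form_U0 !const_form_U1 !mulr1 mulr0 subr0 oner_eq0.
move=> v _ _ _ _; split.
- exact: annul_zero_form oW Wp (z _ _ fp d0 d1).
- exact: annul_zero_form oW Wp (z _ _ (flat_pairC fp) d1 d0).
Qed.

(** * Outputs that depend on the input *)

Section InputDependent.
Variables (phi0 phi1 : J -> R).
Local Notation P0 := (grad phi0 U0).
Local Notation P1 := (grad phi0 U1).
Local Notation Q0 := (grad phi1 U0).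
Local Notation Q1 := (grad phi1 U1).

(** The factor by which (f0, f1) is a multiple of (P0, P1), when it is one;
    dividing by the sum of squares avoids a choice of a nonzero component. *)
Definition ratio (f0 f1 : J -> R) p : R :=
  (P0 p * f0 p + P1 p * f1 p) / (P0 p * P0 p + P1 p * P1 p).

(** In the notation of the introductory comment, [ratio Q0 Q1] is c and [coef]
    is c_1. *)
Definition omega k p := grad phi1 k p - ratio Q0 Q1 p * grad phi0 k p.

Definition coef p := ratio (L omega U0) (L omega U1) p.

Definition zeta k p := L omega k p - coef p * grad phi0 k p.

Variable W : set J.
Hypothesis fp : flat_pair W phi0 phi1.
Hypothesis P_neq0 : forall p, W p -> (P0 p != 0) || (P1 p != 0).

Let oW : open W. Proof. by case: fp. Qed.
Let W0 : forall p, W p -> u0 p != 0. Proof. by case: fp. Qed.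
Let s0 : smooth W phi0. Proof. by case: fp. Qed.
Let s1 : smooth W phi1. Proof. by case: fp. Qed.
Let o0 : order0 W (grad phi0). Proof. by case: fp. Qed.
Let o1 : order0 W (grad phi1). Proof. by case: fp. Qed.
Let sg0 : smooth_form W (grad phi0). Proof. exact: smooth_grad_form. Qed.
Let sg1 : smooth_form W (grad phi1). Proof. exact: smooth_grad_form. Qed.
Let sF k : smooth W (fld k). Proof. exact: smooth_field. Qed.

Lemma smooth_ratio f0 f1 : smooth W f0 -> smooth W f1 -> smooth W (ratio f0 f1).
Proof.
move=> sf0 sf1; apply: smoothM => //; first by apply: smoothD => //; exact: smoothM.
apply: smoothV => // [p Wp|]; first exact: sqr_sum_neq0 (P_neq0 Wp).
by apply: smoothD => //; exact: smoothM.
Qed.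

Lemma ratioE f0 f1 p : W p -> P0 p * f1 p - P1 p * f0 p = 0 ->
  f0 p = ratio f0 f1 p * P0 p /\ f1 p = ratio f0 f1 p * P1 p.
Proof.
move=> Wp E; exact: (parallel2 E (sqr_sum_neq0 (P_neq0 Wp))).
Qed.

Lemma smooth_omega : smooth_form W omega.
Proof.
by move=> k; apply: smoothB => //; apply: smoothM => //; exact: smooth_ratio.
Qed.

Lemma output_gradE p : W p ->
  Q0 p = ratio Q0 Q1 p * P0 p /\ Q1 p = ratio Q0 Q1 p * P1 p.
Proof. by move=> Wp; apply: ratioE => //; exact: input_jacobian_det fp Wp. Qed.

Lemma dx_omega : dx_form W omega.
Proof.
move=> l j p Wp; rewrite /omega; have [q0 q1] := output_gradE Wp.
have [->|l0] := eqVneq l ord0; last by rewrite o0 ?o1 ?lt0n // mulr0 subr0.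
case: j => -[|[|//]] lj.
  rewrite (_ : Ordinal lj = ord0); last exact: val_inj.
  by rewrite [X in X - _]q0 subrr.
rewrite (_ : Ordinal lj = ord_max); last exact: val_inj.
by rewrite [X in X - _]q1 subrr.
Qed.

Lemma smooth_coef : smooth W coef.
Proof. by apply: smooth_ratio; apply: smooth_lie => //; exact: smooth_omega. Qed.

Lemma smooth_zeta : smooth_form W zeta.
Proof.
move=> k; apply: smoothB => //; first by apply: smooth_lie => //; exact: smooth_omega.
by apply: smoothM => //; exact: smooth_coef.
Qed.

Lemma annul_phi1 b v p : W p -> annul b omega v p -> annul b (grad phi0) v p ->
  annul b (grad phi1) v p.
Proof.
by move=> Wp ao a0; exact: (annul_sub oW W0 Wp (smooth_ratio (sg1 U0) (sg1 U1)) sg1 sg0).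
Qed.

Lemma annul_lie_omega b v p : W p -> annul b zeta v p -> annul b (grad phi0) v p ->
  annul b (L omega) v p.
Proof.
move=> Wp aze a0; apply: (annul_sub oW W0 Wp smooth_coef _ sg0 aze a0) => k.
by apply: smooth_lie => //; exact: smooth_omega.
Qed.

(** The du-part of L omega has components omega(df/du_j).  Were it independent
    of the du-part of d phi_1, the forms d phi_1, L omega and omega would
    generate everything. *)
Lemma omega_orth p : W p -> P0 p * L omega U1 p - P1 p * L omega U0 p = 0.
Proof.
move=> Wp; apply/eqP; apply/negP => /negP D.
apply: (too_few_forms fp Wp o0 (order0_lie oW dx_omega) (dx_order0 dx_omega)
  (dx_order0 dx_omega) D) => v p0 _ a0 a1; split=> //.
by apply: annul_phi1 => //; exact: annul_lie.
Qed.

Lemma coefE p : W p -> L omega U0 p = coef p * P0 p /\ L omega U1 p = coef p * P1 p.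
Proof. by move=> Wp; apply: ratioE => //; exact: omega_orth. Qed.

Lemma dx_zeta : dx_form W zeta.
Proof.
move=> l j p Wp; rewrite /zeta; have [q0 q1] := coefE Wp.
have [->|l0] := eqVneq l ord0; last first.
  by rewrite o0 ?lt0n // mulr0 subr0 (order0_lie oW dx_omega) ?lt0n.
case: j => -[|[|//]] lj.
  rewrite (_ : Ordinal lj = ord0); last exact: val_inj.
  by rewrite [X in X - _]q0 subrr.
rewrite (_ : Ordinal lj = ord_max); last exact: val_inj.
by rewrite [X in X - _]q1 subrr.
Qed.

(** As for [omega_orth], with d phi_1, L zeta, omega and zeta. *)
Lemma zeta_orth p : W p -> P0 p * L zeta U1 p - P1 p * L zeta U0 p = 0.
Proof.
move=> Wp; apply/eqP; apply/negP => /negP D.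
apply: (too_few_forms fp Wp o0 (order0_lie oW dx_zeta) (dx_order0 dx_omega)
  (dx_order0 dx_zeta) D) => v p0 p1 a0 a1; split=> //.
apply: annul_phi1 => //; apply: annul_lie => //.
by apply: annul_lie_omega => //; exact: annul_lie.
Qed.

Lemma omega_eq0_absurd p : W p -> (forall k q, W q -> omega k q = 0) -> False.
Proof.
move=> Wp om0.
apply: (proportional_absurd fp Wp _ om0 o0 o0 (P_neq0 Wp)) => //.
exact: smooth_ratio.
Qed.

(** If zeta were a multiple of omega, L omega would lie in the module generated
    by d phi_1 and omega, and d phi_1 and omega alone would generate
    everything. *)
Lemma zeta_multiple_absurd g p : W p -> smooth W g ->
  (forall k q, W q -> zeta k q - g q * omega k q = 0) -> False.
Proof.
move=> Wp sg ze0.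
apply: (too_few_forms fp Wp o0 (@order0_const W (- P1 p) (P0 p))
  (dx_order0 dx_omega) (dx_order0 dx_omega)).
  by rewrite symbol_det_const sqr_sum_neq0 ?P_neq0.
move=> v p0 _ a0 _; split=> //; apply: annul_phi1 => //.
have so := smooth_omega; have sze := smooth_zeta.
suff H b : (b <= r)%N -> annul b omega v p by exact: H.
elim: b => [|b IH] br; first by move=> i; rewrite leqn0 => /eqP ->.
apply/annulS; split=> //; have a0' := annul_le (ltnW br) a0.
apply: annul_lie_omega => //.
have az : annul b (fun k q => zeta k q - g q * omega k q) v p by exact: annul_zero_form oW Wp ze0.
exact: (annul_sub oW W0 Wp sg sze so az (IH (ltnW br))).
Qed.

Let at_ k h (sh : smooth W h) := has_der_grad k sh.
Let dg k : derivation W (fun h => grad h k) := derivation_grad oW k.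

Lemma order0_ratio : order0 W (grad (ratio Q0 Q1)).
Proof.
move=> l j p l0 Wp; pose k : idx := inr (l, j).
have sr : smooth W (ratio Q0 Q1) by exact: smooth_ratio.
have Oq k' : has_der W (fun h => grad h k) (grad phi1 k') (fun=> 0).
  by split=> // q Wq; exact: (order0_grad oW k' s1 o1 _ l0 Wq).
have OP k' q : W q -> grad (grad phi0 k') k q = 0.
  by move=> Wq; exact: (order0_grad oW k' s0 o0 _ l0 Wq).
exact: (der_coef_eq0 oW (dg k) (at_ k (sg0 U0)) (at_ k (sg0 U1)) (at_ k sr)
  (Oq U0) (Oq U1) (OP U0) (OP U1) P_neq0 (fun q Wq => (output_gradE Wq).1)
  (fun q Wq => (output_gradE Wq).2) Wp).
Qed.

Lemma order0_omega i : order0 W (grad (omega (inl i))).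
Proof.
move=> l j p l0 Wp; pose k : idx := inr (l, j).
have sr : smooth W (ratio Q0 Q1) by exact: smooth_ratio.
have := der_sub_mul oW (dg k) (at_ k (smooth_omega (inl i))) (at_ k (sg1 (inl i)))
  (at_ k sr) (at_ k (sg0 (inl i))) (fun q Wq => erefl) Wp.
rewrite (order0_grad oW _ s1 o1 _ l0 Wp) (order0_grad oW _ s0 o0 _ l0 Wp).
by rewrite (order0_ratio _ l0 Wp) mul0r mulr0 addr0 subr0.
Qed.

Lemma order0_coef : order0 W (grad coef).
Proof.
move=> l j p l0 Wp; pose k : idx := inr (l, j).
have Os : has_der W (fun h => grad h k) s (fun=> 0).
  have [ss sd] := slope_der oW W0 k; split=> // q Wq; rewrite sd //.
  have -> : (k == U1) = false by apply/eqP => -[] l1 _; rewrite l1 in l0.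
  have -> : (k == U0) = false by apply/eqP => -[] l1 _; rewrite l1 in l0.
  by rewrite mulr0 subr0 mul0r.
have Ow i : has_der W (fun h => grad h k) (omega (inl i)) (fun=> 0).
  by split=> [|q Wq]; [exact: smooth_omega|exact: order0_omega].
have OP k' q : W q -> grad (grad phi0 k') k q = 0.
  by move=> Wq; exact: (order0_grad oW k' s0 o0 _ l0 Wq).
have z0 q : W q -> (0 : R) = 0 by [].
have [OA OB] := has_der_orth0 oW (dg k) Os (Ow 0) (Ow 1) (Ow ord_max) z0 z0 z0 z0.
have A q : W q -> omega X0 q - s q * s q * 2^-1 * omega X2 q = coef q * P0 q.
  by move=> Wq; exact: etrans (esym (lie_U0 oW W0 dx_omega Wq)) (proj1 (coefE Wq)).
have B q : W q -> omega X1 q + s q * omega X2 q = coef q * P1 q.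
  by move=> Wq; exact: etrans (esym (lie_U1 oW W0 dx_omega Wq)) (proj2 (coefE Wq)).
exact: (der_coef_eq0 oW (dg k) (at_ k (sg0 U0)) (at_ k (sg0 U1)) (at_ k smooth_coef)
  OA OB (OP U0) (OP U1) P_neq0 A B Wp).
Qed.

(** Differentiate the vanishing Jacobian determinant in the direction [k] and
    exchange the order of differentiation. *)
Lemma ratio_phi_ker k p : W p ->
  P0 p * grad (grad phi1 k) U1 p - P1 p * grad (grad phi1 k) U0 p =
  ratio Q0 Q1 p * (P0 p * grad (grad phi0 k) U1 p - P1 p * grad (grad phi0 k) U0 p).
Proof.
move=> Wp; have H := der_ker oW (dg k) (at_ k (sg0 U0)) (at_ k (sg0 U1))
  (at_ k (sg1 U0)) (at_ k (sg1 U1)) (fun q Wq => input_jacobian_det fp Wq) Wp.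
have [q0 q1] := output_gradE Wp.
exact: (ker_transfer H q0 q1 (grad_swap oW U0 k s0 Wp) (grad_swap oW U1 k s0 Wp)
  (grad_swap oW U0 k s1 Wp) (grad_swap oW U1 k s1 Wp)).
Qed.

Lemma ratio_ker p : W p ->
  P0 p * grad (ratio Q0 Q1) U1 p - P1 p * grad (ratio Q0 Q1) U0 p = 0.
Proof.
move=> Wp; have sr : smooth W (ratio Q0 Q1) by exact: smooth_ratio.
have H k k' (E : forall q, W q -> grad phi1 k q = ratio Q0 Q1 q * grad phi0 k q) :=
  der_identity (dg k') (at_ k' (sg1 k)) (has_derM oW (dg k') (at_ k' sr) (at_ k' (sg0 k)))
   E Wp.
have q0 q (Wq : W q) := (output_gradE Wq).1; have q1 q (Wq : W q) := (output_gradE Wq).2.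
exact: (ker_coef (H U0 U0 q0) (H U0 U1 q0) (H U1 U0 q1) (H U1 U1 q1)
  (ratio_phi_ker U0 Wp) (ratio_phi_ker U1 Wp) (P_neq0 Wp)).
Qed.

Lemma omega_ker i p : W p ->
  P0 p * grad (omega (inl i)) U1 p - P1 p * grad (omega (inl i)) U0 p = 0.
Proof.
move=> Wp; have sr : smooth W (ratio Q0 Q1) by exact: smooth_ratio.
have H k := der_sub_mul oW (dg k) (at_ k (smooth_omega (inl i))) (at_ k (sg1 (inl i)))
  (at_ k sr) (at_ k (sg0 (inl i))) (fun q Wq => erefl) Wp.
exact: (ker_sub_mul (H U0) (H U1) (ratio_phi_ker (inl i) Wp) (ratio_ker Wp)).
Qed.

End InputDependent.

(** omega is nonzero somewhere, and where it is nonzero zeta is somewhere not a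
    multiple of it; near such a point the straight-line argument applies. *)
Lemma input_dependent_absurd W phi0 phi1 p : flat_pair W phi0 phi1 -> W p ->
  (forall q, W q -> (grad phi0 U0 q != 0) || (grad phi0 U1 q != 0)) -> False.
Proof.
move=> fp Wp P_neq0; have [oW W0 s0 s1 o0 o1 _] := fp.
pose om := omega phi0 phi1; pose n q := om X0 q * om X0 q + om X1 q * om X1 q + om X2 q * om X2 q.
have so := smooth_omega fp P_neq0.
have sn : smooth W n by exact: smooth_dot3.
have [q [Wq nq]] : exists q, W q /\ n q != 0.
  apply/not_existsP => H; apply: (omega_eq0_absurd fp P_neq0 Wp) => k q Wq.
  case: k => [i|[l j]]; last exact: (dx_omega fp P_neq0).
  have nq : n q = 0 by apply/eqP; apply/negP => /negP nq; exact: (H q).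
  have [e0 e1 e2] := sqr_sum3_eq0 nq.
  by case: (ord3_case i) => ->; [exact: e0|exact: e1|exact: e2].
pose W1 := W `&` [set y | n y != 0].
have oW1 : open W1 by exact: open_neq0.
have W1W : W1 `<=` W by move=> y [].
have fp1 := flat_pair_sub oW1 W1W fp.
have P1_neq0 y : W1 y -> _ := fun W1y => P_neq0 y (W1W y W1y).
pose ze := zeta phi0 phi1.
have sze := smooth_zeta fp1 P1_neq0; have so1 := smooth_omega fp1 P1_neq0.
pose m01 y := om X0 y * ze X1 y - om X1 y * ze X0 y.
pose m02 y := om X0 y * ze X2 y - om X2 y * ze X0 y.
pose m12 y := om X1 y * ze X2 y - om X2 y * ze X1 y.
pose m y := m01 y * m01 y + m02 y * m02 y + m12 y * m12 y.
have sm (i j : idx) : smooth W1 (fun y => om i y * ze j y - om j y * ze i y).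
  exact: smooth_minor.
have sm' : smooth W1 m by exact: smooth_dot3 (sm _ _) (sm _ _) (sm _ _) (sm _ _) (sm _ _) (sm _ _).
have [y [W1y my]] : exists y, W1 y /\ m y != 0.
  apply/not_existsP => H.
  pose g y := (om X0 y * ze X0 y + om X1 y * ze X1 y + om X2 y * ze X2 y) * (n y)^-1.
  have sg : smooth W1 g.
    apply: smoothM => //.
      exact: smooth_dot3.
    by apply: smoothV => // [y []//|]; exact: smooth_sub sn.
  apply: (zeta_multiple_absurd fp1 P1_neq0 (conj Wq nq : W1 q) sg) => k y W1y.
  case: k => [i|[l j]]; last first.
    by rewrite (dx_omega fp1 P1_neq0) // (dx_zeta fp1 P1_neq0) // mulr0 subr0.
  have my : m y = 0 by apply/eqP; apply/negP => /negP my; exact: (H y).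
  have [e0 e1 e2] := sqr_sum3_eq0 my.
  have [f0 f1 f2] := parallel3 e0 e1 e2 W1y.2.
  by case: (ord3_case i) => ->; [exact: f0|exact: f1|exact: f2].
pose W2 := W1 `&` [set y | m y != 0].
have oW2 : open W2 by exact: open_neq0.
have W2W1 : W2 `<=` W1 by move=> x [].
have fp2 := flat_pair_sub oW2 W2W1 fp1.
have P2_neq0 x : W2 x -> _ := fun W2x => P1_neq0 x (W2W1 x W2x).
have [_ W20 s20 s21 o20 o21 _] := fp2.
have dx2 := dx_omega fp2 P2_neq0; have dz2 := dx_zeta fp2 P2_neq0.
apply: (straight_lines_absurd K0 oW2 W20 s20 (smooth_coef fp2 P2_neq0)
  (smooth_omega fp2 P2_neq0) (smooth_zeta fp2 P2_neq0) o20 (order0_coef fp2 P2_neq0)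
  (order0_omega fp2 P2_neq0) P2_neq0 (omega_ker fp2 P2_neq0) _ _ _ _ _ _ _ _
  (conj W1y my : W2 y)).
- move=> x W2x; have := omega_orth fp2 P2_neq0 W2x.
  by rewrite (lie_U0 oW2 W20 dx2 W2x) (lie_U1 oW2 W20 dx2 W2x).
- move=> x W2x; have := zeta_orth fp2 P2_neq0 W2x.
  by rewrite (lie_U0 oW2 W20 dz2 W2x) (lie_U1 oW2 W20 dz2 W2x).
- move=> x W2x.
  exact: etrans (esym (lie_U0 oW2 W20 dx2 W2x)) (proj1 (coefE fp2 P2_neq0 W2x)).
- move=> x W2x.
  exact: etrans (esym (lie_U1 oW2 W20 dx2 W2x)) (proj2 (coefE fp2 P2_neq0 W2x)).
- by move=> x W2x; rewrite /zeta (lie_X0 oW2 W20 _ W2x).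
- by move=> x W2x; rewrite /zeta (lie_X1 oW2 W20 _ W2x).
- by move=> x W2x; rewrite /zeta (lie_X2 oW2 W20 _ W2x).
- move=> x [_ /eqP mx] [e0 e1 e2]; apply: mx.
  exact: (sqr_sum3_0 e0 e1 e2).
Qed.

(** Either one of the outputs depends on the input near some point, or neither
    does anywhere. *)
Lemma flat_pair_absurd W phi0 phi1 : flat_pair W phi0 phi1 -> W !=set0 -> False.
Proof.
have dep f0 f1 p : flat_pair W f0 f1 -> W p ->
    (grad f0 U0 p != 0) || (grad f0 U1 p != 0) -> False.
  move=> fp Wp P_neq0; have [oW W0 s0 s1 o0 o1 _] := fp.
  pose n q := grad f0 U0 q * grad f0 U0 q + grad f0 U1 q * grad f0 U1 q.
  have sn : smooth W n.
    by apply: smoothD => //; apply: smoothM => //; exact: smooth_grad.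
  pose W1 := W `&` [set y | n y != 0].
  have oW1 : open W1 by exact: open_neq0.
  have W1W : W1 `<=` W by move=> y [].
  have W1p : W1 p by split=> //; exact: sqr_sum_neq0.
  apply: (input_dependent_absurd (flat_pair_sub oW1 W1W fp) W1p) => q [_ nq].
  case: (boolP (_ || _)) => // /negP/nor_neq0 [e0 e1]; move: nq;
  by rewrite /= /n e0 e1 mulr0 addr0 eqxx.
move=> fp [p Wp]; have [oW W0 s0 s1 o0 o1 _] := fp.
have free f0 f1 : flat_pair W f0 f1 -> dx_form W (grad f0).
  move=> fp'; have [_ _ _ _ o0' _ _] := fp'.
  have z q (Wq : W q) := nor_neq0 (dep _ _ q fp' Wq).
  by apply: dx_grad => // q Wq; have [] := z q Wq.
exact: (input_free_absurd fp Wp (free _ _ fp) (free _ _ (flat_pairC fp))).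
Qed.

End Obstruction.

Theorem proposition6 (R : realType) :
  ~ exists phi : 'I_2 -> jet R 3 2 0 -> R,
      xu_flat_output (@sys R) (@sys_dom R) phi.
Proof.
move=> [phi flat].
have [|r [K [W [rK oW Wn [WD sphi H]]]]] := flat_output_kernel _ flat.
  move=> K W oW WD k; apply: smooth_field => // p Wp.
  by have := WD p Wp; rewrite /sys_dom /= mxE.
rewrite addn0 in rK.
have K0 : (0 < K)%N by exact: leq_ltn_trans rK.
have W0 p : W p -> @jet_coord R 3 2 K (inr (ord0, ord0)) p != 0.
  by move=> /WD; rewrite /sys_dom /= mxE.
pose f j := phi j \o @jet_trunc R 3 2 0 K.
have o0 j : order0 W (grad (@jet_dir R 3 2 K) (f j)).
  move=> l i p l0 Wp; rewrite /grad derive_trunc jet_trunc_dir_gt ?derive0 //.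
apply: (@flat_pair_absurd R K r K0 (ltnW rK) W (f ord0) (f ord_max)) => //.
split; [exact: oW|exact: W0|exact: sphi|exact: sphi|exact: o0|exact: o0|].
move=> p v Wp a0 a1; apply: (H p v Wp) => j b br.
have sf j' : smooth W (f j') := sphi j'.
have aj : annul (@jet_dir R 3 2 K) (jet_field (@sys R)) r (grad (@jet_dir R 3 2 K) (f j)) v p.
  case: j => -[|[|//]] lj.
    by rewrite (_ : Ordinal lj = ord0) //; exact: val_inj.
  by rewrite (_ : Ordinal lj = ord_max) //; exact: val_inj.
by apply: (annul_grad oW _ (sf j) Wp aj br) => k; exact: smooth_field.
Qed.
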